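(* Let $c>0$ and let $(p_m)_{m\geq1}$ be a sequence in $[0,1)$ with $p_m\sim c/m$ as $m\to\infty$; write $p=p_m$. Let $(Q_t)_{t\geq0}$ be the continuous-time birth-death process on $\{0,1,2,\dots\}$ with $Q_0\sim\operatorname{Poisson}(c)$, transitions $n\mapsto n+1$ at rate $c$ and transitions $n\mapsto n-1$ at rate $n$, and let $\tau_c=\inf\{t\geq0 : Q_t=0\}$. If $G$ is a standard Gumbel random variable independent of $\tau_c$, then $(T_{m,p}-m\log m)/m$ converges in law, as $m\to\infty$, to $G+\tau_c$.
   Context: For an integer $m\geq 1$, let $\{C_n\}_{n\geq 1}$ be uniformly distributed on $[m]=\{1,\dots,m\}$ and $\{U_n\}_{n\geq1}$ be uniformly distributed on $(0,1)$, with the whole family $\{U_n,C_n\}_{n\geq1}$ independent. For $i\in[m]$ and $n>0$ let $L(i,n)=\sup\{1\leq k\leq n : C_k=i\}$ (with $\sup\emptyset=-\infty$). For $p\in[0,1)$ the clumsy coupon collection time is $$T_{m,p}=\inf\{n>0 : L(i,n)>0 \text{ and } U_{L(i,n)}\leq 1-p \text{ for all } i\in[m]\}.$$ The standard Gumbel distribution has cumulative distribution function $F(x)=\exp(-e^{-x})$, $x\in\mathbb{R}$. *)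

(* Defs.v *)
From HB Require Import structures.
From mathcomp Require Import all_boot all_order all_algebra.
From mathcomp Require Import all_classical all_reals all_analysis.
From mathcomp Require Import measurable_realfun.

Set Implicit Arguments.
Unset Strict Implicit.
Unset Printing Implicit Defensive.

Import Order.TTheory GRing.Theory Num.Theory.
Import numFieldNormedType.Exports.

Local Open Scope classical_set_scope.
Local Open Scope ring_scope.

Definition sigma_of (T : Type) (d' : measure_display) (T' : measurableType d')
    (X : T -> T') : set (set T) :=
  preimage_set_system setT X measurable.

Definition mutually_independent (R : realType) (d : measure_display)
    (T : measurableType d) (P : probability T R) (I : eqType)
    (F : I -> set (set T)) : Prop :=
  forall (s : seq I) (A : I -> set T), uniq s ->
    (forall i, i \in s -> F i (A i)) ->
    P (\bigcap_(i in [set` s]) A i) = (\prod_(i <- s) P (A i))%E.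

(* The sequences are only constrained at indices n >= 1. *)
Definition coupon_draws (R : realType) (d : measure_display)
    (T : measurableType d) (P : probability T R) (m : nat)
    (C : nat -> {RV P >-> nat}) (U : nat -> {RV P >-> R}) : Prop :=
  [/\ forall n i, (0 < n)%N -> (1 <= i <= m)%N ->
        P (C n @^-1` [set i]) = (m%:R^-1)%:E,
      forall n, (0 < n)%N -> forall B : set R, measurable B ->
        distribution P (U n) B = uniform_prob ltr01 B &
      mutually_independent P (fun k : nat + nat =>
        match k with
        | inl n => sigma_of (U n.+1)
        | inr n => sigma_of (C n.+1)
        end)].

(* L(i, n); the value 0 encodes sup of the empty set, i.e. -oo. *)
Definition last_draw (T : Type) (C : nat -> T -> nat) (i n : nat) (w : T) : nat :=
  \max_(1 <= k < n.+1 | C k w == i) k.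

Definition clumsy_complete (R : realType) (T : Type) (m : nat) (p : R)
    (C : nat -> T -> nat) (U : nat -> T -> R) (n : nat) (w : T) : Prop :=
  forall i, (1 <= i <= m)%N ->
    (0 < last_draw C i n w)%N /\ U (last_draw C i n w) w <= 1 - p.

Definition clumsy_time (R : realType) (T : Type) (m : nat) (p : R)
    (C : nat -> T -> nat) (U : nat -> T -> R) (w : T) : \bar R :=
  ereal_inf [set n%:R%:E | n in
    [set n : nat | (0 < n)%N /\ clumsy_complete m p C U n w]].

Definition jump_prob (R : realType) (birth death : nat -> R) (i j : nat) : R :=
  if j == i.+1 then birth i / (birth i + death i)
  else if i == j.+1 then death i / (birth i + death i)
  else 0.

(* Right-continuous birth-death process, for rates with birth i + death i > 0
   in every state and death 0 = 0, described by its jump chain Y and holding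
   times S: given Y, the S k are independent, exponential with parameter the
   total rate of Y k.  Nothing is imposed on Q from the explosion time
   \sum_k S k on, which is almost surely infinite for the rates used here.
   Only times t >= 0 matter. *)
Definition birth_death_process (R : realType) (d : measure_display)
    (T : measurableType d) (P : probability T R) (birth death : nat -> R)
    (Q : R -> {RV P >-> nat}) : Prop :=
  (forall w t, 0 <= t -> \forall s \near t^'+, Q s w = Q t w) /\
  exists (Y : nat -> {RV P >-> nat}) (S : nat -> {RV P >-> R}),
    (forall (n : nat) (i : nat -> nat) (A : nat -> set R),
       (forall k, measurable (A k)) ->
       P (\bigcap_(k in [set k | (k <= n)%N])
            (Y k @^-1` [set i k] `&` S k @^-1` A k)) =
       (P (Q 0%R @^-1` [set i 0%N])
        * (\prod_(0 <= k < n) jump_prob birth death (i k) (i k.+1))%R%:E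
        * \prod_(0 <= k < n.+1)
            exponential_prob (birth (i k) + death (i k))%R (A k))%E) /\
    {ae P, forall w, forall (n : nat) (t : R),
       \sum_(0 <= k < n) S k w <= t < \sum_(0 <= k < n.+1) S k w ->
       Q t w = Y n w}.

Definition hitting_time0 (R : realType) (T : Type) (Q : R -> T -> nat) (w : T) :
    \bar R :=
  ereal_inf [set t%:E | t in [set t : R | 0 <= t /\ Q t w = 0%N]].

Definition standard_gumbel (R : realType) (d : measure_display)
    (T : measurableType d) (P : probability T R) (G : {RV P >-> R}) : Prop :=
  forall x : R, cdf G x = (expR (- expR (- x)))%:E.

(* The variables are extended real valued because hitting times may be
   infinite on a negligible set.  Almost sure finiteness of the limit Z makes
   convergence of distribution functions exclude any escape of mass. *)
Definition cvg_in_law (R : realType)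
    (d : nat -> measure_display) (T : forall m, measurableType (d m))
    (P : forall m, probability (T m) R) (X : forall m, T m -> \bar R)
    (d' : measure_display) (T' : measurableType d') (P' : probability T' R)
    (Z : T' -> \bar R) : Prop :=
  {ae P', forall w, Z w \is a fin_num} /\
  forall x : R,
    {for x, continuous (fun y : R => P' [set w | (Z w <= y%:E)%E])} ->
    P m [set w | (X m w <= x%:E)%E] @[m --> \oo] --> P' [set w | (Z w <= x%:E)%E].

(* Main.v *)
(* Let E_n be the event that the collection is complete at time n, and rho =
   1 - e^-c. Since the process regenerates at its first completion T, one has
     P(E_n) = sum_{k <= n} P(T = k) v(n - k),
   where v(j) is the probability of being complete j draws after a completion.
   Inclusion-exclusion and Tannery's theorem give v(m y) -> w(y) :=
   exp(-c (1 - e^-y)) and P(E_n) -> e^-c exp(-e^-t) for n = m log m + m t.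
   Now w(y) is also the probability that the stationary M/M/infinity queue, once
   empty, is empty again y later, so E[w(t - tau); tau <= t] = e^-c for t >= 0,
   and convolving with the Gumbel law, E[w(t - Z); Z <= t] = e^-c exp(-e^-t) for
   Z = G + tau. Hence the distribution functions of the normalised T and of Z
   satisfy asymptotically the same renewal equation. As w decreases from 1 to
   e^-c, approximating it by step functions makes the difference D of the two
   distribution functions satisfy |D(t)| <= rho max_r |D(t - r)| + o(1) for
   finitely many shifts r, and rho < 1 forces D -> 0. *)

From HB Require Import structures.
Require Import Defs.
From mathcomp Require Import all_boot all_order all_algebra.
From mathcomp Require Import all_classical all_reals all_analysis.
From mathcomp Require Import measurable_realfun.
From mathcomp Require Import ring lra zify.
Import Order.TTheory GRing.Theory Num.Theory.
Import numFieldNormedType.Exports.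
Local Open Scope classical_set_scope.
Local Open Scope ring_scope.
Set Implicit Arguments.
Unset Strict Implicit.
Unset Printing Implicit Defensive.

(** The limit queue counts the faulty coupons: in m draws about m p, hence c, coupons turn faulty,
    and each is redrawn, so repaired, at rate about 1. The law of T has no tractable closed form
    while completeness at a fixed time does, hence the detour through a renewal equation. The law of
    tau is not computed either: it enters only through E[w(t - tau); tau <= t] = e^-c, the
    probability that the stationary queue is empty at time t, split at its first visit to 0.
    Comparing two solutions of one equation settles existence and identity of the limit together,
    without transforms or tightness. Bounds on D hold for each t separately once m is large; this
    survives finitely many shifts but not a continuum of them, which is why the kernel has to become
    a step function. On the queue side, the process is given by a jump chain and holding times, not
    by a semigroup. The identity for tau is therefore a martingale identity along the chain stopped
    at 0, whose remainder vanishes because a Lyapunov function bounds the mean number of jumps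
    before 0. *)

Lemma cvg_near_eq (R : realType) (u v : nat -> R) (l : R) :
  u n @[n --> \oo] --> l -> (\forall n \near \oo, u n = v n) ->
  v n @[n --> \oo] --> l.
Proof. by move=> h uv; apply: cvg_trans h; exact: near_eq_cvg. Qed.

Lemma cvg_near_dist (R : realType) (u : nat -> R) (l e : R) :
  u n @[n --> \oo] --> l -> 0 < e -> \forall n \near \oo, `|l - u n| <= e.
Proof. by move/cvgrPdist_le; apply. Qed.

Lemma cvg_near_le (R : realType) (u : nat -> R) (l x : R) :
  u n @[n --> \oo] --> l -> (\forall n \near \oo, u n <= x) -> l <= x.
Proof.
move=> h ux; rewrite -(cvg_lim (@Rhausdorff R) h); apply: limr_le => //.
by apply/cvg_ex; exists l.
Qed.

(** * Asymptotics of the occupancy sums *)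

(** Dominated convergence for sums whose length grows with m: past a fixed K both tails are below
    the tail of [series b], and the first K terms converge one by one. *)
Lemma tannery (R : realType) (f : nat -> nat -> R) (l b : nat -> R) :
  (forall k, f m k @[m --> \oo] --> l k) ->
  (\forall m \near \oo, forall k, `|f m k| <= b k) ->
  cvgn (series b) ->
  \sum_(0 <= k < m.+1) f m k @[m --> \oo] --> limn (series l).
Proof.
move=> fl fb cb.
have lb k : `|l k| <= b k.
  apply: (cvg_near_le (cvg_norm (fl k))).
  by apply: filterS fb => m.
have b0 k : 0 <= b k by exact: le_trans (lb k).
have ndb : {homo series b : n m / (n <= m)%N >-> n <= m}.
  by apply/nondecreasing_seqP => n; rewrite !seriesEnat/= big_nat_recr//= lerDl.
have bB n : series b n <= limn (series b) by exact: nondecreasing_cvgn_le.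
have cl : cvgn (series l).
  apply: normed_cvg; apply: series_le_cvg cb => // k; exact: normr_ge0.
have seg (g : nat -> R) K n : (K <= n)%N -> (forall k, `|g k| <= b k) ->
    `|series g n - series g K| <= limn (series b) - series b K.
  move=> Kn gb; rewrite sub_series_geq//.
  apply: (le_trans (ler_norm_sum _ _ _)).
  apply: (@le_trans _ _ (\sum_(K <= k < n) b k)); first exact: ler_sum.
  by rewrite -(sub_series_geq b Kn) lerD2r.
apply/cvgrPdist_le => e e0.
have e3 : 0 < e / 3 by rewrite divr_gt0.
have [K _ hK] := cvg_near_dist cb e3.
have {}hK : limn (series b) - series b K <= e / 3.
  by apply: le_trans (hK K (leqnn K)); exact: ler_norm.
have lK : `|limn (series l) - series l K| <= e / 3.
  apply: le_trans hK.
  apply: (cvg_near_le (u := fun n => `|series l n - series l K|)).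
    by apply: cvg_norm; apply: cvgB => //; exact: cvg_cst.
  by exists K => // n /= Kn; exact: seg.
have sK : \sum_(0 <= k < K) f m k @[m --> \oo] --> series l K.
  rewrite seriesEnat /=.
  elim: (K) => [|j IH].
    under eq_fun do rewrite big_geq//.
    by rewrite big_geq//; exact: cvg_cst.
  under eq_fun do rewrite big_nat_recr//=.
  by rewrite big_nat_recr//=; apply: cvgD => //; exact: fl.
have {}sK := cvg_near_dist sK e3.
near=> m.
have Km : (K <= m.+1)%N by apply: leqW; near: m; exists K.
have fm : `|\sum_(0 <= k < m.+1) f m k - \sum_(0 <= k < K) f m k| <= e / 3.
  apply: le_trans hK; have := @seg (f m) K m.+1 Km; rewrite !seriesEnat/=; apply.
  by near: m; apply: filterS fb => m.
have sm : `|series l K - \sum_(0 <= k < K) f m k| <= e / 3 by near: m.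
move: lK sm fm.
move: (limn _) (series l K) (\sum_(0 <= k < K) _) (\sum_(0 <= k < m.+1) _) => A B C D.
rewrite !ler_norml => /andP[? ?] /andP[? ?] /andP[? ?]; apply/andP; split; lra.
Unshelve. all: by end_near.
Qed.

(* Inclusion-exclusion: with q the odds p / (1 - p) of a faulty coupon,
   (1 - p)^e * bgen m e q n is the probability that, after n draws among m
   coupons, none of e given coupons, all held at the start, is faulty; q = -1
   corresponds to starting without any coupon. *)
Definition bgen (R : realType) (m e : nat) (q : R) (n : nat) : R :=
  \sum_(0 <= k < e.+1) 'C(e, k)%:R * q ^+ k * (1 - k%:R / m%:R) ^+ n.

Lemma bgen0 (R : realType) (m e : nat) (q : R) : bgen m e q 0 = (1 + q) ^+ e.
Proof.
rewrite exprDn /bgen big_mkord; apply: eq_bigr => i _.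
by rewrite expr0 mulr1 expr1n mul1r mulr_natl.
Qed.

(** One draw either misses the e coupons or hits one of them, whose status it then settles, leaving
    e - 1. This is the recursion that [wsum_held] matches with conditioning on the most recent
    draw. *)
Lemma bgenS (R : realType) (m e : nat) (q : R) (n : nat) :
  bgen m e q n.+1 =
  (1 - e%:R / m%:R) * bgen m e q n + e%:R / m%:R * bgen m e.-1 q n.
Proof.
have -> : e%:R / m%:R * bgen m e.-1 q n = e%:R / m%:R *
    \sum_(0 <= k < e.+1) 'C(e.-1, k)%:R * q ^+ k * (1 - k%:R / m%:R) ^+ n.
  case: e => [|e]; first by rewrite !mul0r.
  by congr (_ * _); rewrite [RHS]big_nat_recr//= bin_small// !mul0r addr0.
rewrite /bgen !big_distrr/= -big_split/= big_nat_cond [RHS]big_nat_cond.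
apply: eq_bigr => k; rewrite andbT ltnS => ke.
have h : (e%:R : R) * 'C(e.-1, k)%:R = (e%:R - k%:R) * 'C(e, k)%:R.
  by rewrite -natrB// -!natrM mul_bin_down.
rewrite exprS.
have -> : e%:R / m%:R * ('C(e.-1, k)%:R * q ^+ k * (1 - k%:R / m%:R) ^+ n) =
  (e%:R * 'C(e.-1, k)%:R) / m%:R * (q ^+ k * (1 - k%:R / m%:R) ^+ n) by ring.
by rewrite h; ring.
Qed.

Lemma cvg_natV (R : realType) : (m%:R^-1 : R) @[m --> \oo] --> (0 : R).
Proof. by rewrite -(cvg_shiftS (fun m => m%:R^-1 : R)); exact: cvg_harmonic. Qed.

Lemma bernoulli_ineq (R : realType) (x : R) (n : nat) :
  0 <= x <= 1 -> 1 - n%:R * x <= (1 - x) ^+ n.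
Proof.
move=> /andP[x0 x1]; elim: n => [|n IH]; first by rewrite mul0r subr0 expr0.
rewrite exprS; apply: (@le_trans _ _ ((1 - x) * (1 - n%:R * x))).
  have : 0 <= n%:R * x * x by rewrite !mulr_ge0.
  rewrite -natr1; lra.
by rewrite ler_wpM2l// subr_ge0.
Qed.

Lemma ffact_le_expn (n k : nat) : (n ^_ k <= n ^ k)%N.
Proof.
elim: k => [|k IH]; first by rewrite ffactn0 expn0.
by rewrite ffactnSr expnSr leq_mul// leq_subr.
Qed.

Lemma cvg_ffact_ratio (R : realType) (k : nat) :
  ((m ^_ k)%:R / m%:R ^+ k : R) @[m --> \oo] --> (1 : R).
Proof.
elim: k => [|k IH].
  by under eq_fun do rewrite ffactn0 expr0 divr1; exact: cvg_cst.
have h : (1 - k%:R * m%:R^-1 : R) @[m --> \oo] --> (1 : R).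
  rewrite -[X in _ --> X]subr0 -[X in _ --> _ - X](mulr0 (k%:R)).
  apply: cvgB; first exact: cvg_cst.
  apply: cvgM; [exact: cvg_cst|exact: cvg_natV].
rewrite -[X in _ --> X]mulr1; apply: (cvg_near_eq (cvgM IH h)).
exists k.+1 => // m /= km.
rewrite ffactnSr natrM natrB ?(ltnW km)// exprS.
have m0 : (m%:R : R) != 0 by rewrite pnatr_eq0 -lt0n (leq_ltn_trans _ km).
have mk0 : (m%:R ^+ k : R) != 0 by rewrite expf_neq0.
field.
by rewrite m0 mk0.
Qed.

(** The k-th term is asymptotic to (m q e^(-n/m))^k / k!, so [tannery] yields an exponential series.
    The statement covers both regimes in use: q of order c/m with n of order m, and q = -1 with n
    near m log m + m t. *)
Lemma bgen_cvg (R : realType) (q : nat -> R) (n : nat -> nat) (lam : R) :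
  (m%:R * q m * expR (- ((n m)%:R / m%:R))) @[m --> \oo] --> lam ->
  ((n m)%:R / m%:R ^+ 2 : R) @[m --> \oo] --> (0 : R) ->
  bgen m m (q m) (n m) @[m --> \oo] --> expR lam.
Proof.
move=> alam n2.
pose a m := m%:R * q m * expR (- ((n m)%:R / m%:R)).
have -> : expR lam = limn (series (exp_coeff lam)) by [].
have cE k : exp_coeff lam k = lam ^+ k / k`!%:R by rewrite exp_coeffE/= mulrC.
apply: (tannery (b := exp_coeff (`|lam| + 1))); last exact: is_cvg_series_exp_coeff.
- move=> k; rewrite cE.
  have h1 : (1 - (n m)%:R * (k%:R / m%:R) ^+ 2 : R) @[m --> \oo] --> (1 : R).
    rewrite -[X in _ --> X]subr0 -[X in _ --> _ - X](mulr0 (k%:R ^+ 2)).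
    apply: cvgB; first exact: cvg_cst.
    apply: (cvg_near_eq (cvgM (cvg_cst (k%:R ^+ 2 : R)) n2)); near=> m.
    by rewrite /= expr_div_n; ring.
  (* This trades (1 - k/m)^n for e^(-k n/m). With x = k/m, the inequalities 1 - x^2 <= (1 - x) e^x
     <= 1 and Bernoulli's put the n-th power between 1 - n x^2 and 1, and n/m^2 -> 0 closes the
     gap. *)
  have h2 : (((1 - k%:R / m%:R) * expR (k%:R / m%:R)) ^+ n m : R) @[m --> \oo] --> (1 : R).
    apply: (squeeze_cvgr _ h1 (cvg_cst _)).
    exists k.+1 => // m /= km.
    have m0 : 0 < (m%:R : R) by rewrite ltr0n (leq_ltn_trans _ km).
    have x01 : 0 <= (k%:R / m%:R : R) <= 1.
      by rewrite divr_ge0//= ler_pdivrMr// mul1r ler_nat ltnW.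
    move: (k%:R / m%:R) x01 => x /andP[x0 x1].
    apply/andP; split; last first.
      apply: exprn_ile1; first by rewrite mulr_ge0 ?expR_ge0// subr_ge0.
      have := expR_ge1Dx (- x).
      rewrite -(ler_pM2r (expR_gt0 x)) -expRD addNr expR0; lra.
    apply: (@le_trans _ _ ((1 - x ^+ 2) ^+ n m)).
      by apply: bernoulli_ineq; rewrite sqr_ge0/= expr_le1.
    have y0 : 0 <= 1 - x ^+ 2 by rewrite subr_ge0 expr_le1.
    have h : 1 - x ^+ 2 <= (1 - x) * expR x.
      have -> : 1 - x ^+ 2 = (1 - x) * (1 + x) by ring.
      by rewrite ler_wpM2l ?subr_ge0// expR_ge1Dx.
    by rewrite lerXn2r// nnegrE (le_trans y0).
  have ak : (a m ^+ k : R) @[m --> \oo] --> (lam ^+ k : R).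
    by apply: (@cvg_comp _ _ _ a (fun x => x ^+ k) _ (nbhs lam)) => //; exact: exprn_continuous.
  rewrite (_ : lam ^+ k / k`!%:R = 1 * lam ^+ k / k`!%:R * 1); last by ring.
  have h3 := cvgM (cvgM (cvgM (cvg_ffact_ratio k) ak) (cvg_cst (k`!%:R^-1 : R))) h2.
  apply: (cvg_near_eq (h3 _ _ _ _)).
  exists k.+1 => // m /= km.
  have m0 : (m%:R : R) != 0 by rewrite pnatr_eq0 -lt0n (leq_ltn_trans _ km).
  have mk0 : (m%:R ^+ k : R) != 0 by rewrite expf_neq0.
  have k0 : (k`!%:R : R) != 0 by rewrite pnatr_eq0 -lt0n fact_gt0.
  rewrite /a -bin_ffact natrM !exprMn -!expRM_natl.
  rewrite [X in _ * _ * _ * (_ * X)](_ : _ = (expR (k%:R * - ((n m)%:R / m%:R)))^-1).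
    have e0 : expR (k%:R * - ((n m)%:R / m%:R)) != 0 :> R.
      by rewrite gt_eqF// expR_gt0.
    move: mk0 k0 e0; move: (m%:R ^+ k) (k`!%:R) (expR (_ * _)) ((1 - _) ^+ _).
    by move=> A B C D *; field; apply/and3P.
  by rewrite -expRN; congr expR; ring.
- have := @cvg_near_dist _ a _ 1 alam ltr01.
  apply: filterS2 (nbhs_infty_gt 0) => m m1 am k.
  have {}am : `|a m| <= `|lam| + 1.
    move: am; rewrite ler_distlC => /andP[am1 am2].
    have := ler_norm lam; have := ler_norm (- lam); rewrite normrN => h1 h2.
    rewrite ler_norml; apply/andP; split; lra.
  have m0 : 0 < (m%:R : R) by rewrite ltr0n.
  have [km|km] := leqP k m; last first.
    by rewrite bin_small// !mul0r normr0 exp_coeff_ge0// addr_ge0.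
  rewrite exp_coeffE/= [leRHS]mulrC.
  have x1 : 0 <= 1 - k%:R / m%:R :> R.
    by rewrite subr_ge0 ler_pdivrMr// mul1r ler_nat.
  rewrite !normrM normr_nat normrX (ger0_norm (exprn_ge0 _ x1)).
  apply: (@le_trans _ _ (`|a m| ^+ k / k`!%:R)); last first.
    by rewrite ler_wpM2r// lerXn2r// ?nnegrE// addr_ge0.
  rewrite /a !normrM normr_nat (ger0_norm (expR_ge0 _)).
  have hC : 'C(m, k)%:R <= m%:R ^+ k / k`!%:R :> R.
    rewrite ler_pdivlMr ?ltr0n ?fact_gt0// -natrM bin_ffact -natrX ler_nat.
    exact: ffact_le_expn.
  have hx : (1 - k%:R / m%:R) ^+ n m <= expR (- ((n m)%:R / m%:R)) ^+ k :> R.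
    rewrite -expRM_natl.
    have -> : k%:R * - ((n m)%:R / m%:R) = (n m)%:R * (- (k%:R / m%:R)) :> R by ring.
    by rewrite expRM_natl lerXn2r ?nnegrE ?expR_ge0//; exact: expR_ge1Dx.
  rewrite [X in _ <= X](_ : _ = m%:R ^+ k / k`!%:R * `|q m| ^+ k * expR (- ((n m)%:R / m%:R)) ^+ k).
    apply: ler_pM; [|exact: exprn_ge0| |exact: hx].
      by apply: mulr_ge0; rewrite ?exprn_ge0.
    by rewrite ler_wpM2r// exprn_ge0.
  by rewrite !exprMn; ring.
Unshelve. all: by end_near.
Qed.

Lemma cvgM_near_eq (R : realType) (u v w : nat -> R) (a b l : R) :
  u n @[n --> \oo] --> a -> v n @[n --> \oo] --> b -> a * b = l ->
  (\forall n \near \oo, u n * v n = w n) -> w n @[n --> \oo] --> l.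
Proof. by move=> ua vb <-; apply: cvg_near_eq; exact: cvgM. Qed.

Lemma cvg_expR_comp (R : realType) (u : nat -> R) (l : R) :
  u n @[n --> \oo] --> l -> expR (u n) @[n --> \oo] --> expR l.
Proof. by move=> h; apply: continuous_cvg h; exact: continuous_expR. Qed.

Lemma cvg_ln_div (R : realType) : (ln m%:R / m%:R : R) @[m --> \oo] --> (0 : R).
Proof.
(* The bound is 2/s for m = s^2, because ln m = 2 ln s <= 2 s. *)
have h : (2 * Num.sqrt (m%:R^-1) : R) @[m --> \oo] --> (0 : R).
  rewrite [X in _ --> X](_ : 0 = 2 * Num.sqrt 0); last by rewrite sqrtr0 mulr0.
  apply: cvgM; first exact: cvg_cst.
  by apply: (continuous_cvg _ (@sqrt_continuous R 0)); exact: cvg_natV.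
apply: (squeeze_cvgr _ (cvg_cst (0 : R)) h).
apply: filterS (nbhs_infty_gt 0) => m m0.
have m0' : 0 < m%:R :> R by rewrite ltr0n.
rewrite divr_ge0 ?ln_ge0 ?ler1n//=.
have [s s0 sE] : exists2 s : R, 0 < s & m%:R = s ^+ 2.
  by exists (Num.sqrt m%:R); rewrite ?sqrtr_gt0// sqr_sqrtr// ltW.
rewrite sqrtrV ?(ltW m0')// sE sqrtr_sqr ger0_norm ?(ltW s0)// lnXn//.
rewrite ler_pdivrMr ?exprn_gt0// expr2 mulrA -(mulrA 2) mulVf ?gt_eqF// mulr1.
by rewrite mulr_natl lerMn2r ltW ?orbT// ln_sublinear.
Qed.

Lemma truncn_div_cvg (R : realType) (x : nat -> R) :
  (\forall m \near \oo, 0 <= x m) ->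
  (x m / m%:R - (Num.truncn (x m))%:R / m%:R : R) @[m --> \oo] --> (0 : R).
Proof.
move=> x0; apply: (@squeeze_cvgr _ _ _ _ (fun=> 0) (fun m => m%:R^-1)); last 2 first.
- exact: cvg_cst.
- exact: cvg_natV.
apply: filterS2 x0 (nbhs_infty_gt 0) => m x0 m0.
have m0' : 0 < m%:R :> R by rewrite ltr0n.
have /andP[h1 h2] := truncn_itv x0.
rewrite -mulrBl divr_ge0 ?subr_ge0//= -[leRHS]mul1r ler_wpM2r ?invr_ge0//.
by rewrite lerBlDr addrC natr1 ltW.
Qed.

Section clumsy_asymptotics.
Context {R : realType}.
Variables (c : R) (p : nat -> R).
Hypothesis p01 : forall m, (0 < m)%N -> 0 <= p m < 1.
Hypothesis pc : p ~_\oo (fun m : nat => c / m%:R).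

Lemma cvg_natM_equiv : (m%:R * p m : R) @[m --> \oo] --> c.
Proof.
apply/cvgrPdist_le => e e0.
have e1 : 0 < e / (`|c| + 1) by rewrite divr_gt0// ltr_wpDl.
have /= /eqaddoP/(_ _ e1) := pc.
apply: filterS2 (nbhs_infty_gt 0) => m m0 /=.
have m0' : 0 < m%:R :> R by rewrite ltr0n.
rewrite -(ler_pM2l m0') -{1}(ger0_norm (ltW m0')) -normrM => h.
rewrite distrC (_ : m%:R * p m - c = m%:R * (p m - c / m%:R)); last first.
  by field; rewrite gt_eqF.
apply: (le_trans h); rewrite normrM normfV (ger0_norm (ltW m0')).
rewrite [leLHS](_ : _ = e * (`|c| / (`|c| + 1))); last first.
  by field; rewrite !gt_eqF// ltr_wpDl.
by rewrite ger_pMr// ler_pdivrMr ?ltr_wpDl// mul1r lerDl.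
Qed.

Lemma cvg_equiv0 : p m @[m --> \oo] --> (0 : R).
Proof.
apply: cvgM_near_eq; [exact: cvg_natM_equiv|exact: cvg_natV|exact: mulr0|].
apply: filterS (nbhs_infty_gt 0) => m m0 /=.
by field; rewrite pnatr_eq0 -lt0n.
Qed.

Lemma cvg_odds : (m%:R * (p m / (1 - p m)) : R) @[m --> \oo] --> c.
Proof.
have h : ((1 - p m)^-1 : R) @[m --> \oo] --> (1 : R).
  rewrite -[X in _ --> X]invr1; apply: cvgV; first exact: oner_neq0.
  rewrite -[X in _ --> X]subr0; apply: cvgB; [exact: cvg_cst|exact: cvg_equiv0].
apply: cvgM_near_eq; [exact: cvg_natM_equiv|exact: h|exact: mulr1|].
by apply: nearW => m /=; rewrite mulrA.
Qed.

Lemma cvg_bgen_odds (n : nat -> nat) (y : R) :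
  ((n m)%:R / m%:R : R) @[m --> \oo] --> y ->
  bgen m m (p m / (1 - p m)) (n m) @[m --> \oo] --> expR (c * expR (- y)).
Proof.
move=> ny; apply: bgen_cvg.
  apply: cvgM; first exact: cvg_odds.
  by apply: cvg_expR_comp; apply: cvgN.
apply: cvgM_near_eq; [exact: ny|exact: cvg_natV|exact: mulr0|].
by apply: nearW => m /=; rewrite expr2 invfM mulrA.
Qed.

(** With q the odds, 1 + q is the inverse of 1 - p, so [bgen] at time 0 is the inverse of (1 - p)^m;
    the case y = 0 of [cvg_bgen_odds] then suffices. *)
Lemma cvg_exprn_1B : ((1 - p m) ^+ m : R) @[m --> \oo] --> expR (- c).
Proof.
have h : ((0%N)%:R / m%:R : R) @[m --> \oo] --> (0 : R).
  by under eq_fun do rewrite mul0r; exact: cvg_cst.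
have := cvg_bgen_odds h; rewrite oppr0 expR0 mulr1 expRN => h2.
have e0 : expR c != 0 by rewrite gt_eqF// expR_gt0.
apply: (cvg_near_eq (cvgV e0 h2)).
apply: filterS (nbhs_infty_gt 0) => m m0 /=.
have /andP[p0 p1] := p01 m0.
rewrite bgen0 -exprVn; congr (_ ^+ _).
have : 1 - p m != 0 by rewrite gt_eqF// subr_gt0.
move=> np; rewrite -[RHS]invrK; congr (_^-1).
by field.
Qed.

(* The probability that the collection is complete n draws after a time at
   which it was complete (clumsy_return), respectively empty (clumsy_full). *)
Definition clumsy_return (m n : nat) : R :=
  (1 - p m) ^+ m * bgen m m (p m / (1 - p m)) n.

Definition clumsy_full (m n : nat) : R := (1 - p m) ^+ m * bgen m m (- 1) n.

Definition mminf_return (y : R) : R := expR (- (c * (1 - expR (- y)))).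

Lemma cvg_clumsy_return (y : R) : 0 <= y ->
  clumsy_return m (Num.truncn (m%:R * y)) @[m --> \oo] --> mminf_return y.
Proof.
move=> y0; rewrite /mminf_return mulrBr mulr1 opprB addrC expRD.
apply: cvgM; first exact: cvg_exprn_1B.
apply: cvg_bgen_odds.
have h := truncn_div_cvg (x := fun m => m%:R * y).
have {}h := h _; rewrite -[X in _ --> X]subr0.
apply: (cvg_near_eq (cvgB (cvg_cst y) (h _))).
  by apply: nearW => m; rewrite mulr_ge0.
apply: filterS (nbhs_infty_gt 0) => m m0 /=.
by rewrite !fctE; field; rewrite pnatr_eq0 -lt0n.
Qed.

Lemma cvg_clumsy_full (t : R) :
  clumsy_full m (Num.truncn (m%:R * ln m%:R + m%:R * t)) @[m --> \oo] -->
  expR (- c) * expR (- expR (- t)).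
Proof.
apply: cvgM; first exact: cvg_exprn_1B.
pose x m : R := m%:R * ln m%:R + m%:R * t.
have x0 : \forall m \near \oo, 0 <= x m.
  apply: filterS2 (nbhs_infty_gt 0) (nbhs_infty_ger (expR (- t))) => m m0 me.
  rewrite /x -mulrDr mulr_ge0// -lerBlDr sub0r -(expRK (- t)) ler_ln// posrE ?expR_gt0//.
  by rewrite ltr0n.
have xm := truncn_div_cvg x0.
apply: bgen_cvg.
  (* As x/m = log m + t, the product m e^(-x/m) is exactly e^-t; only the rounding error between x/m
     and n/m is left, and it tends to 0. *)
  apply: (cvgM_near_eq (cvg_cst (- expR (- t))) (cvg_expR_comp xm)).
    by rewrite expR0 mulr1.
  apply: filterS (nbhs_infty_gt 0) => m m0 /=.
  have m0' : 0 < m%:R :> R by rewrite ltr0n.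
  rewrite expRD (_ : x m / m%:R = ln m%:R + t); last by rewrite /x; field; rewrite gt_eqF.
  rewrite expRD lnK ?posrE// expRN.
  have : expR t != 0 by rewrite gt_eqF// expR_gt0.
  by rewrite /x; move: (expR (- _)) => A ?; field.
have xm2 : (x m / m%:R ^+ 2 : R) @[m --> \oo] --> (0 : R).
  rewrite [X in _ --> X](_ : 0 = 0 + t * 0); last by rewrite mulr0 addr0.
  apply: (cvg_near_eq (cvgD (@cvg_ln_div R) (cvgM (cvg_cst t) (@cvg_natV R)))).
  apply: filterS (nbhs_infty_gt 0) => m m0 /=.
  by rewrite /x; field; rewrite pnatr_eq0 -lt0n.
apply: (squeeze_cvgr _ (cvg_cst (0 : R)) xm2).
apply: filterS x0 => m x0; rewrite divr_ge0 ?exprn_ge0//=.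
by rewrite ler_wpM2r ?invr_ge0 ?exprn_ge0//; have /andP[] := truncn_itv x0.
Qed.

(** The term k = 0 of [bgen] is 1 and the others are nonnegative, the odds being so. This floor, of
    limit e^-c, is what [step_approx] needs beyond the last grid point. *)
Lemma clumsy_return_ge (m n : nat) : (0 < m)%N ->
  (1 - p m) ^+ m <= clumsy_return m n.
Proof.
move=> m0; have /andP[p0 p1] := p01 m0.
have q0 : 0 <= p m / (1 - p m) by rewrite divr_ge0// subr_ge0 ltW.
rewrite /clumsy_return -[leLHS]mulr1 ler_wpM2l ?exprn_ge0 ?subr_ge0 ?(ltW p1)//.
rewrite /bgen big_nat_recl// bin0 expr0 mul0r subr0 expr1n !mulr1 lerDl.
rewrite big_nat_cond; apply: sumr_ge0 => k /andP[/andP[_ km] _].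
rewrite !mulr_ge0 ?exprn_ge0// subr_ge0 ler_pdivrMr ?ltr0n// mul1r ler_nat.
by [].
Qed.

Lemma clumsy_return_noninc (m n n' : nat) : (0 < m)%N -> (n <= n')%N ->
  clumsy_return m n' <= clumsy_return m n.
Proof.
move=> m0 nn'; have /andP[p0 p1] := p01 m0.
have q0 : 0 <= p m / (1 - p m) by rewrite divr_ge0// subr_ge0 ltW.
rewrite /clumsy_return ler_wpM2l ?exprn_ge0 ?subr_ge0 ?(ltW p1)//.
rewrite /bgen big_nat_cond [leRHS]big_nat_cond.
apply: ler_sum => k /andP[/andP[_ km] _].
rewrite ler_wpM2l ?mulr_ge0 ?exprn_ge0//.
have h : 0 <= (k%:R / m%:R : R) <= 1.
  by rewrite divr_ge0//= ler_pdivrMr ?ltr0n// mul1r ler_nat.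
by apply: ler_wiXn2l => //; move: h => /andP[]; rewrite ?subr_ge0 ?gerBl.
Qed.

End clumsy_asymptotics.

(** * The renewal equation *)

Section coupon_lists.
Context {R : realType}.
Variables (m : nat) (p : R).
Hypothesis m0 : (0 < m)%N.
Implicit Types (s : seq (nat * bool)) (d : nat -> bool).

(** Finite means over lists of draws keep the regeneration argument free of measure theory;
    [P_draws] later identifies them with probabilities. *)
Definition draw_values : seq (nat * bool) :=
  [seq (i, b) | i <- iota 1 m, b <- [:: true; false]].

Definition draw_weight (x : nat * bool) : R :=
  m%:R^-1 * (if x.2 then 1 - p else p).

(* The mean of f over n independent draws; a draw pairs a coupon with its success. *)
Fixpoint wsum (n : nat) (f : seq (nat * bool) -> R) : R :=
  if n is n'.+1 then
    \sum_(x <- draw_values) draw_weight x * wsum n' (fun s => f (x :: s))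
  else f [::].

Lemma sum_draw_values (f : nat * bool -> R) :
  \sum_(x <- draw_values) draw_weight x * f x =
  \sum_(i <- iota 1 m) m%:R^-1 * ((1 - p) * f (i, true) + p * f (i, false)).
Proof.
rewrite /draw_values big_allpairs_dep; apply: eq_bigr => i _.
by rewrite !big_cons big_nil /draw_weight/= addr0; ring.
Qed.

Lemma sum_draw_weight : \sum_(x <- draw_values) draw_weight x = 1.
Proof.
have := sum_draw_values (fun=> 1).
under eq_bigr do rewrite mulr1.
move=> ->; under eq_bigr do rewrite !mulr1 subrK mulr1.
by rewrite big_const_seq count_predT size_iota iter_addr_0 -(mulr_natr m%:R^-1) mulVf// pnatr_eq0 -lt0n.
Qed.

Lemma eq_wsum (n : nat) (f g : seq (nat * bool) -> R) :
  (forall s, size s = n -> all (mem draw_values) s -> f s = g s) ->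
  wsum n f = wsum n g.
Proof.
elim: n f g => [|n IH] f g fg /=; first exact: fg.
apply: eq_big_seq => x xin; congr (_ * _); apply: IH => s sn sin.
by apply: fg; rewrite /= ?sn// sin andbT.
Qed.

Lemma wsum_sum (n : nat) (I : Type) (r : seq I) (f : I -> seq (nat * bool) -> R) :
  wsum n (fun s => \sum_(k <- r) f k s) = \sum_(k <- r) wsum n (f k).
Proof.
elim: n f => [//|n IH] f /=.
rewrite exchange_big/=; apply: eq_bigr => x _.
by rewrite IH big_distrr.
Qed.

Lemma wsumZ (n : nat) (k : R) (f : seq (nat * bool) -> R) :
  wsum n (fun s => k * f s) = k * wsum n f.
Proof.
elim: n f => [//|n IH] f /=; rewrite big_distrr; apply: eq_bigr => x _.
by rewrite IH mulrCA.
Qed.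

(** Independence of the a most recent draws from the b draws before them. *)
Lemma wsum_cat (a b : nat) (f g : seq (nat * bool) -> R) :
  wsum (a + b) (fun s => f (take a s) * g (drop a s)) = wsum a f * wsum b g.
Proof.
elim: a f => [|a IH] f /=.
  by rewrite add0n -wsumZ; apply: eq_wsum => s _ _; rewrite take0 drop0.
by rewrite big_distrl/=; apply: eq_bigr => x _; rewrite (IH (fun s => f (x :: s))) mulrA.
Qed.

Lemma wsum1 (n : nat) : wsum n (fun=> 1) = 1.
Proof.
by elim: n => [//|n IH] /=; under eq_bigr do rewrite IH mulr1; exact: sum_draw_weight.
Qed.

Lemma wsum_ge0 (n : nat) (f : seq (nat * bool) -> R) :
  0 <= p <= 1 -> (forall s, 0 <= f s) -> 0 <= wsum n f.
Proof.
move=> /andP[p0 p1]; elim: n f => [|n IH] f f0 /=; [exact: f0|]; apply: sumr_ge0 => x _.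
rewrite mulr_ge0 ?IH// /draw_weight mulr_ge0 ?invr_ge0//.
by case: x.2; rewrite ?subr_ge0.
Qed.

(* Lists of draws start with the most recent one; d is the state before them. *)
Fixpoint held d s (i : nat) : bool :=
  if s is x :: s' then if x.1 == i then x.2 else held d s' i else d i.

Lemma held_cat d s1 s2 : held d (s1 ++ s2) =1 held (held d s2) s1.
Proof. by move=> i; elim: s1 => [//|x s1 IH] /=; rewrite IH. Qed.

Lemma eq_held d d' s (r : seq nat) : {in r, d =1 d'} -> {in r, held d s =1 held d' s}.
Proof.
by move=> dd' i ir; elim: s => [|x s IH] /=; rewrite ?dd'// IH.
Qed.

Definition holds_all d s : bool := all (held d s) (iota 1 m).

(** The set A makes the induction work: it holds the coupons that more recent draws have already
    settled favourably. When the most recent draw is peeled off, a failure outside A destroys the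
    event and a success outside A enlarges A, which gives the recursion [bgenS] in the number of
    coupons outside A. The hypothesis on q is the case n = 0; it is met by q = -1 for an empty start
    and by the odds p / (1 - p) for a full one. *)
Lemma wsum_held (b : bool) (A : seq nat) (n : nat) (q : R) :
  (1 - p) * (1 + q) = b%:R ->
  wsum n (fun s => (all (fun i => (i \in A) || held (fun=> b) s i) (iota 1 m))%:R) =
  (1 - p) ^+ count (fun i => i \notin A) (iota 1 m) *
  bgen m (count (fun i => i \notin A) (iota 1 m)) q n.
Proof.
move=> bq; elim: n A => [|n IH] A /=.
  rewrite bgen0 -exprMn bq.
  case: b {bq} => /=; first by rewrite expr1n (eq_all (a2 := predT)) ?all_predT// => i; rewrite orbT.
  rewrite expr0n; congr (nat_of_bool _)%:R.
  by rewrite -leqn0 leqNgt -has_count -all_predC; apply: eq_all => i /=; rewrite orbF negbK.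
set e := count _ _.
rewrite sum_draw_values.
have step (i : nat) (ib : bool) s :
    all (fun j => (j \in A) || held (fun=> b) ((i, ib) :: s) j) (iota 1 m) =
    if i \in A then all (fun j => (j \in A) || held (fun=> b) s j) (iota 1 m)
    else (ib || (i \notin iota 1 m)) && all (fun j => (j \in i :: A) || held (fun=> b) s j) (iota 1 m).
  case: ifPn => iA.
    by apply: eq_all => j /=; case: eqP => // <-; rewrite iA.
  apply/idP/andP => [/allP h|[h1 /allP h2]].
    split.
      case: ib h => //= h; apply/negP => /h /=; rewrite eqxx (negbTE iA).
      by [].
    apply/allP => j jr; have := h j jr; rewrite /= inE eq_sym.
    by case: eqP => //= _.
  apply/allP => j jr; have := h2 j jr; rewrite /= inE eq_sym.
  case: eqP => [ij|_] //= _; move: h1; rewrite ij jr orbF => ->.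
  by rewrite orbT.
have rest (i : nat) : i \in iota 1 m -> i \notin A ->
    count (fun j => j \notin i :: A) (iota 1 m) = e.-1.
  move=> ir iA; have -> : e = (count (pred1 i) (iota 1 m) + count (fun j => j \notin i :: A) (iota 1 m))%N.
    rewrite -count_predUI [X in (_ + X)%N](eq_count (a2 := pred0)).
      rewrite count_pred0 addn0; apply: eq_count => j /=; rewrite inE negb_or.
      by case: eqP => [->|]//=; rewrite iA.
    by move=> j /=; rewrite inE negb_or; case: eqP.
  by rewrite (count_uniq_mem _ (iota_uniq _ _)) ir.
have val (i : nat) : i \in iota 1 m ->
    (1 - p) * wsum n (fun s => (all (fun j => (j \in A) || held (fun=> b) ((i, true) :: s) j) (iota 1 m))%:R)
    + p * wsum n (fun s => (all (fun j => (j \in A) || held (fun=> b) ((i, false) :: s) j) (iota 1 m))%:R)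
    = if i \in A then (1 - p) ^+ e * bgen m e q n
      else (1 - p) * ((1 - p) ^+ e.-1 * bgen m e.-1 q n).
  move=> ir; case: ifPn => iA.
    rewrite !(eq_wsum (g := fun s => (all (fun j => (j \in A) || held (fun=> b) s j) (iota 1 m))%:R)) => [|s _ _|s _ _].
    - by rewrite IH -/e; ring.
    - by rewrite step iA.
    - by rewrite step iA.
  rewrite (eq_wsum (g := fun s => (all (fun j => (j \in i :: A) || held (fun=> b) s j) (iota 1 m))%:R)); last first.
    by move=> s _ _; rewrite step (negbTE iA).
  rewrite [X in p * X](eq_wsum (g := fun=> 0 * 0)); last first.
    by move=> s _ _; rewrite step (negbTE iA)/= ir mul0r.
  by rewrite wsumZ mul0r mulr0 addr0 IH rest.
under eq_big_seq => i ir do rewrite val//.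
rewrite -big_distrr/= (bigID (fun i => i \in A))/=.
under eq_bigr => i iA do rewrite iA.
under [X in _ * (_ + X)]eq_bigr => i iA do rewrite (negbTE iA).
have sumc (P : pred nat) (k : R) : \sum_(i <- iota 1 m | P i) k = (count P (iota 1 m))%:R * k.
  by rewrite big_const_seq iter_addr_0 mulr_natl.
rewrite !sumc -/e.
have me : (count (fun i => i \in A) (iota 1 m) + e = m)%N.
  by rewrite /e -{3}(size_iota 1 m) -(count_predC (fun i => i \in A)).
have em : (e <= m)%N by rewrite -[X in (_ <= X)%N]me leq_addl.
have -> : count (fun i => i \in A) (iota 1 m) = (m - e)%N by rewrite -[in RHS]me addnK.
rewrite bgenS natrB//.
have m0' : m%:R != 0 :> R by rewrite pnatr_eq0 -lt0n.
case: (e) em => [|e'] em /=; last by rewrite exprS; field.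
by rewrite !mul0r !addr0 subr0; field.
Qed.

Lemma wsum_holds_all (b : bool) (n : nat) (q : R) :
  (1 - p) * (1 + q) = b%:R ->
  wsum n (fun s => (holds_all (fun=> b) s)%:R) = (1 - p) ^+ m * bgen m m q n.
Proof.
move=> /(@wsum_held b [::] n).
by rewrite (eq_count (a2 := predT)) ?count_predT ?size_iota.
Qed.

Fixpoint ever_complete s : bool :=
  holds_all (fun=> false) s || (if s is _ :: s' then ever_complete s' else false).

(* The oldest draws of s are at its tail, so behead s is the past of s. *)
Definition first_complete s : bool :=
  holds_all (fun=> false) s && ~~ ever_complete (behead s).

Lemma ever_complete_nil : ever_complete [::] = false.
Proof. by rewrite /= orbF /holds_all; case: (m) m0. Qed.

Lemma first_complete_nil : first_complete [::] = false.
Proof. by rewrite /first_complete /holds_all; case: (m) m0. Qed.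

(** The first k draws in time are the last k entries of s, hence the [drop]. At most one k is the
    first completion, so the sum of indicators is again an indicator. *)
Lemma ever_completeE s : (ever_complete s)%:R =
  \sum_(0 <= k < (size s).+1) (first_complete (drop (size s - k) s))%:R :> R.
Proof.
elim: s => [|x s IH].
  by rewrite ever_complete_nil big_nat1 first_complete_nil.
rewrite big_nat_recr//= subnn drop0.
have -> : \sum_(0 <= k < (size s).+1) (first_complete (drop ((size s).+1 - k) (x :: s)))%:R = (ever_complete s)%:R :> R.
  rewrite IH; rewrite big_nat_cond [RHS]big_nat_cond; apply: eq_bigr => k.
  by rewrite andbT ltnS => ks; rewrite subSn.
rewrite /first_complete /=.
by case: (ever_complete s); case: (holds_all _ _); rewrite /= ?addr0 ?add0r.
Qed.

(** Regeneration: at a completion every coupon is held, so the later states depend on the later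
    draws alone. *)
Lemma holds_all_cat s1 s2 : holds_all (fun=> false) s2 ->
  holds_all (fun=> false) (s1 ++ s2) = holds_all (fun=> true) s1.
Proof.
move=> /allP h; apply: eq_in_all => i ir; rewrite held_cat.
by apply: (@eq_held _ _ _ (iota 1 m)) => // j jr; exact: h.
Qed.

Lemma wsum_renewal (n : nat) :
  wsum n (fun s => (holds_all (fun=> false) s)%:R) =
  \sum_(0 <= k < n.+1) wsum k (fun s => (first_complete s)%:R) *
    wsum (n - k) (fun s => (holds_all (fun=> true) s)%:R).
Proof.
rewrite (eq_wsum (g := fun s => \sum_(0 <= k < n.+1)
   (holds_all (fun=> true) (take (n - k) s))%:R *
   (first_complete (drop (n - k) s))%:R)); last first.
  move=> s sn _; rewrite -sn.
  (* The second factor costs nothing, since a collection complete now has been complete at some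
     time; it is then split by the first such time. *)
  transitivity ((holds_all (fun=> false) s)%:R * (ever_complete s)%:R : R).
    by case: s {sn} => [|x s] /=; [rewrite ?orbF; case: (holds_all _ _)|case: (holds_all _ _)]; rewrite ?mulr1 ?mul0r ?mulr0.
  rewrite ever_completeE big_distrr/=; apply: eq_bigr => k _.
  case: (boolP (first_complete _)) => [fc|]; last by rewrite !mulr0.
  rewrite !mulr1 -{1}(cat_take_drop (size s - k) s) holds_all_cat//.
  by case/andP: fc.
rewrite wsum_sum big_nat_cond [RHS]big_nat_cond; apply: eq_bigr => k.
rewrite andbT ltnS => kn; rewrite mulrC.
have := wsum_cat (n - k) k (fun s => (holds_all (fun=> true) s)%:R) (fun s => (first_complete s)%:R).
by rewrite subnK.
Qed.

Lemma wsum_ever_complete (n : nat) :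
  wsum n (fun s => (ever_complete s)%:R) =
  \sum_(0 <= k < n.+1) wsum k (fun s => (first_complete s)%:R).
Proof.
rewrite (eq_wsum (g := fun s => \sum_(0 <= k < n.+1)
   1 * (first_complete (drop (n - k) s))%:R)); last first.
  by move=> s sn _; rewrite ever_completeE sn; under [RHS]eq_bigr do rewrite mul1r.
rewrite wsum_sum big_nat_cond [RHS]big_nat_cond; apply: eq_bigr => k.
rewrite andbT ltnS => kn.
have := wsum_cat (n - k) k (fun=> 1) (fun s => (first_complete s)%:R).
by rewrite subnK// => ->; rewrite wsum1 mul1r.
Qed.

End coupon_lists.

(** * Sample paths as lists of draws *)

Section coupon_process.
Context {R : realType} {T : Type}.
Variables (m : nat) (p : R) (C : nat -> T -> nat) (U : nat -> T -> R).
Implicit Types (n : nat) (w : T).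

Fixpoint draws n w : seq (nat * bool) :=
  if n is n'.+1 then (C n w, U n w <= 1 - p) :: draws n' w else [::].

Lemma last_drawS (i n : nat) w :
  last_draw C i n.+1 w = if C n.+1 w == i then n.+1 else last_draw C i n w.
Proof.
rewrite /last_draw big_mkcond big_nat_recr//= -big_mkcond.
case: eqP => [_|_]; last by rewrite maxn0.
apply/maxn_idPr/bigmax_leqP_seq => k; rewrite mem_index_iota => /andP[_ kn] _.
exact: ltnW.
Qed.

Lemma held_draws (i n : nat) w : held (fun=> false) (draws n w) i =
  (0 < last_draw C i n w)%N && (U (last_draw C i n w) w <= 1 - p).
Proof.
elim: n => [|n IH]; first by rewrite /last_draw big_geq.
by rewrite last_drawS /=; case: eqP.
Qed.

Lemma clumsy_completeE n w :
  clumsy_complete m p C U n w <-> holds_all m (fun=> false) (draws n w).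
Proof.
split=> [h|/allP h i i1m].
  apply/allP => i; rewrite mem_iota add1n ltnS => i1m.
  by rewrite held_draws; apply/andP; exact: h.
by apply/andP; rewrite -held_draws h// mem_iota add1n ltnS.
Qed.

Lemma ever_complete_draws n w : ever_complete m (draws n w) <->
  exists2 k, (k <= n)%N & holds_all m (fun=> false) (draws k w).
Proof.
elim: n => [|n IH].
  split=> /= [|[k]]; first by rewrite orbF => h; exists 0%N.
  by rewrite leqn0 => /eqP -> ->.
rewrite [ever_complete _ _]/=; split.
  case/orP => [h|/IH[k kn h]]; first by exists n.+1.
  by exists k => //; exact: leqW.
move=> [k]; rewrite leq_eqVlt => /predU1P[-> ->//|kn hk].
by apply/orP; right; apply/IH; exists k.
Qed.

Lemma clumsy_time_le (x : R) w : (0 < m)%N -> 0 <= x ->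
  (clumsy_time m p C U w <= x%:E)%E = ever_complete m (draws (Num.truncn x) w).
Proof.
move=> m0 x0; have /andP[xN Nx] := truncn_itv x0.
apply/idP/idP; last first.
  move=> /ever_complete_draws[k kN hk]; apply: ge_ereal_inf.
  exists k%:R%:E; last by rewrite lee_fin (le_trans _ xN)// ler_nat.
  exists k => //; split; last exact/clumsy_completeE.
  (* The infimum ranges over positive times; k = 0 is excluded because no coupon is held before the
     first draw and m > 0. *)
  by case: k hk {kN} => //; rewrite /holds_all; case: (m) m0.
apply: contraTT => hN; rewrite -ltNge.
apply: (@lt_le_trans _ _ (Num.truncn x).+1%:R%:E); first by rewrite lte_fin.
apply: le_ereal_inf_tmp => _ [n [n0 /clumsy_completeE hn] <-].
rewrite lee_fin ler_nat ltnNge; apply: contra hN => nN.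
by apply/ever_complete_draws; exists n.
Qed.

End coupon_process.

(** * The law of the list of draws *)

Section coupon_law.
Context {R : realType} {d : measure_display} {T : measurableType d}.
Variables (P : probability T R) (m : nat) (p : R).
Variables (C : nat -> {RV P >-> nat}) (U : nat -> {RV P >-> R}).
Hypothesis m0 : (0 < m)%N.
Hypothesis p01 : 0 <= p < 1.
Hypothesis CU : coupon_draws m C U.

Let X (n : nat) (w : T) : nat * bool := (C n.+1 w, U n.+1 w <= 1 - p).

Definition draw_event (n : nat) (x : nat * bool) : set T := [set w | X n w = x].

Let half (b : bool) : set R := if b then `]-oo, 1 - p]%classic else ~` `]-oo, 1 - p]%classic.

Let measurable_half b : measurable (half b).
Proof. by case: b => //=; exact: measurableC. Qed.

Let draw_eventE (n : nat) (x : nat * bool) :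
  draw_event n x = C n.+1 @^-1` [set x.1] `&` U n.+1 @^-1` half x.2.
Proof.
apply/seteqP; split=> w; case: x => i b; rewrite /draw_event /X /half/=.
  by case=> -> <-; split => //; case: ifPn => /= [|/negP]; rewrite in_itv.
move=> [-> h]; congr pair; case: b h => /=; rewrite in_itv//=.
by move/negP/negbTE.
Qed.

Lemma measurable_draw_event (n : nat) (x : nat * bool) : measurable (draw_event n x).
Proof. by rewrite draw_eventE; apply: measurableI; exact: measurable_funPTI. Qed.

Let U_half (n : nat) (b : bool) : P (U n.+1 @^-1` half b) = (if b then 1 - p else p)%:E.
Proof.
have [_ hU _] := CU; have /andP[p0 p1] := p01.
have h1 : P (U n.+1 @^-1` half true) = (1 - p)%:E.
  have := hU n.+1 isT (half true) (measurable_half true).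
  rewrite /distribution /pushforward => ->; rewrite /uniform_prob integral_uniform_pdf.
  rewrite (_ : half true `&` `[0, 1] = `[0, 1 - p]%classic); last first.
    apply/seteqP; split=> x /=; rewrite !in_itv/=; first by move=> [-> /andP[->]].
    by move=> /andP[-> xp]; split=> //=; rewrite (le_trans xp)// gerBl.
  rewrite (eq_integral (fun=> 1%E)); last first.
    move=> x; rewrite inE/= in_itv/= => /andP[x0 xp].
    by rewrite /uniform_pdf x0 (le_trans xp) ?gerBl// subr0 invr1.
  by rewrite integral_cst//= mul1e lebesgue_measure_itv/= lte_fin subr_gt0 p1 oppr0 adde0.
case: b => //.
rewrite (_ : U n.+1 @^-1` half false = ~` (U n.+1 @^-1` half true))//.
rewrite probability_setC; last exact: measurable_funPTI.
by rewrite h1 -EFinD opprB addrC subrK.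
Qed.

Let wt := draw_weight m p.
Let vals := draw_values m.

Let cyl (n : nat) (l : seq (nat * bool)) : set T :=
  [set w | forall j, (j < size l)%N -> X (n + j) w = nth (0%N, false) l j].

Let cylS n x l : cyl n (x :: l) = draw_event n x `&` cyl n.+1 l.
Proof.
apply/seteqP; split=> w /=.
  move=> h; split; first by have := h 0%N isT; rewrite addn0.
  by move=> j jl; have := h j.+1 jl; rewrite addnS -addSn.
by move=> [h1 h2] [|j] /= jl; [rewrite addn0|rewrite addnS -addSn; exact: h2].
Qed.

Let measurable_cyl n l : measurable (cyl n l).
Proof.
elim: l n => [|x l IH] n.
  by rewrite (_ : cyl n [::] = setT)//; apply/seteqP; split.
by rewrite cylS; apply: measurableI => //; exact: measurable_draw_event.
Qed.

Let P_cyl n0 l : all (mem vals) l -> P (cyl n0 l) = (\prod_(x <- l) wt x)%:E.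
Proof.
move=> lv; have [hC _ hI] := CU.
pose x0 := (0%N, false).
pose A (k : nat + nat) : set T := match k with
  | inl j => setT `&` U j.+1 @^-1` half (nth x0 l (j - n0)).2
  | inr j => setT `&` C j.+1 @^-1` [set (nth x0 l (j - n0)).1]
  end.
(* Each draw uses one index for its uniform variable and one for its coupon; collecting all of them
   in one duplicate-free sequence allows a single use of independence. *)
pose s : seq (nat + nat) := map inl (iota n0 (size l)) ++ map inr (iota n0 (size l)).
have us : uniq s.
  rewrite cat_uniq !map_inj_uniq ?iota_uniq; last 2 first.
  - by move=> ? ? [].
  - by move=> ? ? [].
  rewrite andbT/=; apply/hasPn => k /mapP[j _ ->]; apply/negP => /mapP[j' _]//.
have hA i : i \in s -> (match i with inl n => sigma_of (U n.+1) | inr n => sigma_of (C n.+1) end) (A i).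
  move=> _; case: i => j /=; first by exists (half (nth x0 l (j - n0)).2).
  by exists [set (nth x0 l (j - n0)).1].
have := hI s A us hA.
rewrite (_ : \bigcap_(i in [set` s]) A i = cyl n0 l); last first.
  apply/seteqP; split=> w /= h.
    move=> j jl; have hj : (n0 + j)%N \in iota n0 (size l).
      by rewrite mem_iota leq_addr ltn_add2l.
    have h1 : A (inl (n0 + j)%N) w by apply: h; rewrite /= mem_cat map_f.
    have h2 : A (inr (n0 + j)%N) w by apply: h; rewrite /= mem_cat orbC map_f.
    case: h1 => _; case: h2 => _; rewrite addKn => h2 h1.
    have : (C (n0 + j).+1 @^-1` [set (nth x0 l j).1] `&` U (n0 + j).+1 @^-1` half (nth x0 l j).2) w by [].
    by rewrite -draw_eventE.
  move=> i; rewrite /= mem_cat => /orP[] /mapP[j]; rewrite mem_iota => /andP[nj jl] ->.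
    have jl' : (j - n0 < size l)%N by rewrite ltn_subLR.
    have : draw_event j (nth x0 l (j - n0)) w by have := h _ jl'; rewrite subnKC.
    by rewrite draw_eventE => -[h1 h2]; split.
  have jl' : (j - n0 < size l)%N by rewrite ltn_subLR.
  have : draw_event j (nth x0 l (j - n0)) w by have := h _ jl'; rewrite subnKC.
  by rewrite draw_eventE => -[h1 h2]; split.
move=> ->; rewrite big_cat/= !big_map -big_split/=.
rewrite [in RHS](big_nth x0) -prodEFin /index_iota subn0 -[n0]addn0 iotaDl big_map addn0.
apply: eq_big_seq => j; rewrite mem_iota add0n => /andP[_ jl].
rewrite !setTI U_half addKn.
have := allP lv _ (mem_nth x0 jl) => /allpairsP[[i b] [/= + _ ->]].
rewrite mem_iota add1n ltnS => im /=.
by rewrite hC// /wt /draw_weight/= -EFinM mulrC.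
Qed.

Let P_draw_event n x : x \in vals -> P (draw_event n x) = (wt x)%:E.
Proof.
move=> xv; have := @P_cyl n [:: x]; rewrite /= xv big_seq1 cylS => /(_ isT) <-.
by rewrite (_ : cyl n.+1 [::] = setT) ?setIT//; apply/seteqP; split.
Qed.

Let split_draw_seq n (E : set T) (r : seq (nat * bool)) : measurable E -> uniq r ->
  P ([set w | X n w \in r] `&` E) = (\sum_(x <- r) P (draw_event n x `&` E))%E /\
  measurable [set w | X n w \in r].
Proof.
move=> mE; elim: r => [_|x r IH /= /andP[xr ur]].
  rewrite big_nil (_ : [set w | _] = set0); last by apply/seteqP; split.
  by rewrite set0I measure0.
have [IH1 IH2] := IH ur.
have e : [set w | X n w \in x :: r] = draw_event n x `|` [set w | X n w \in r].
  apply/seteqP; split=> w /=; rewrite inE.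
    by case/orP => [/eqP ?|?]; [left|right].
  by case=> [->|->]; rewrite ?eqxx// orbT.
rewrite e; split; last by apply: measurableU => //; exact: measurable_draw_event.
rewrite setIUl measureU; last 3 first.
- by apply: measurableI => //; exact: measurable_draw_event.
- exact: measurableI.
- apply/seteqP; split => // w [[h1 _] [h2 _]]; move: h2 xr.
  by rewrite /= h1 => ->.
by rewrite big_cons; congr (_ + _)%E; exact: IH1.
Qed.

(** A draw may take values outside [vals], but only on a null set, since the weights over [vals]
    already add up to 1. *)
Let split_draw n (E : set T) : measurable E ->
  P E = (\sum_(x <- vals) P (draw_event n x `&` E))%E.
Proof.
move=> mE.
have uv : uniq vals.
  by apply: allpairs_uniq => //; [exact: iota_uniq|move=> [? ?] [? ?] _ _ []/= -> ->].
have [<- mV] := split_draw_seq n mE uv.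
have [] := split_draw_seq n (@measurableT _ T) uv.
rewrite setIT => h1 _.
have P1 : P [set w | X n w \in vals] = 1%E.
  rewrite h1 -(sum_draw_weight p m0) -sumEFin; apply: eq_big_seq => x xv.
  by rewrite setIT P_draw_event.
have P0 : P (~` [set w | X n w \in vals]) = 0%E by rewrite probability_setC// P1 subee.
rewrite -[in LHS](setIT E) -(setUv [set w | X n w \in vals]) setIUr measureU; last 3 first.
- exact: measurableI.
- by apply: measurableI => //; exact: measurableC.
- by rewrite -setIIr setICr setI0.
rewrite [X in (_ + X)%E](_ : _ = 0%E) ?adde0 ?[E `&` _]setIC//.
apply/eqP; rewrite eq_le measure_ge0 andbT -P0; apply: le_measure.
- by rewrite inE; apply: measurableI => //; exact: measurableC.
- by rewrite inE; exact: measurableC.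
- by move=> ? [].
Qed.

Let measurable_draws n (phi : pred (seq (nat * bool))) :
  measurable [set w | phi (draws p C U n w)].
Proof.
have md s : measurable [set w | draws p C U n w = s].
  elim: n s => [|n IH] [|x s].
  - by rewrite (_ : [set w | _] = setT)//; apply/seteqP; split.
  - by rewrite (_ : [set w | _] = set0)//; apply/seteqP; split.
  - by rewrite (_ : [set w | _] = set0)//; apply/seteqP; split.
  rewrite (_ : [set w | _] = draw_event n x `&` [set w | draws p C U n w = s]).
    by apply: measurableI => //; exact: measurable_draw_event.
  by apply/seteqP; split=> w /=; [case|case=> <- <-].
rewrite (_ : [set w | _] = \bigcup_s (if phi s then [set w | draws p C U n w = s] else set0)).
  apply: countable_bigcupT_measurable; first exact: countableP.
  by move=> s; case: ifP.
apply/seteqP; split=> w /=.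
  by move=> h; exists (draws p C U n w) => //; rewrite h.
by move=> [s _]; case: ifP => // hs /= ->.
Qed.

(** The cylinder fixes the draws after the n-th in chronological order, whereas [draws] lists the
    past backwards. The induction moves the most recent past draw to the front of l, until only
    [P_cyl] is left. *)
Let P_draws_cyl n (phi : pred (seq (nat * bool))) l : all (mem vals) l ->
  P ([set w | phi (draws p C U n w)] `&` cyl n l) =
  (wsum m p n (fun s => (phi s)%:R) * \prod_(x <- l) wt x)%:E.
Proof.
elim: n phi l => [|n IH] phi l lv.
  rewrite /=; case: (phi [::]); last first.
    by rewrite mul0r (_ : [set w | _] = set0) ?set0I ?measure0//; apply/seteqP; split.
  rewrite mul1r (_ : [set w | _] = setT) ?setTI ?P_cyl//; by apply/seteqP; split.
rewrite (split_draw n); last exact: measurableI.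
rewrite /= big_distrl/= -sumEFin; apply: eq_big_seq => x xv.
have := IH (fun s => phi (x :: s)) (x :: l).
rewrite /= xv lv big_cons => /(_ isT).
rewrite -/(wt x) mulrCA mulrA => <-.
congr (P _); rewrite cylS; apply/seteqP; split=> w /=.
  by move=> [h1 [h2 h3]]; rewrite -h1.
by move=> [h1 [h2 h3]]; rewrite -h2 in h1.
Qed.

Lemma P_draws n (phi : pred (seq (nat * bool))) :
  P [set w | phi (draws p C U n w)] = (wsum m p n (fun s => (phi s)%:R))%:E.
Proof.
have := @P_draws_cyl n phi [::] isT; rewrite big_nil mulr1 => <-.
by rewrite (_ : cyl n [::] = setT) ?setIT//; apply/seteqP; split.
Qed.

End coupon_law.

(** * Birth-death process *)

Section density.
Local Open Scope ereal_scope.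
Context {d : measure_display} {T : measurableType d} {R : realType}.
Variables (mu nu : {measure set T -> \bar R}) (g : T -> \bar R).
Hypothesis mg : measurable_fun setT g.
Hypothesis g0 : forall x, 0 <= g x.
Hypothesis gfin : forall x, g x \is a fin_num.
Hypothesis nug : forall A, measurable A -> nu A = \int[mu]_(x in A) g x.

Import HBNNSimple.

Let density_nnsfun (f : {nnsfun T >-> R}) :
  \int[nu]_x (f x)%:E = \int[mu]_x ((f x)%:E * g x).
Proof.
under [LHS]eq_integral do rewrite fimfunE -fsumEFin//.
rewrite [LHS]ge0_integral_fsum//; last 2 first.
  - by move=> r; exact/measurable_EFinP/measurableT_comp.
  - by move=> n x _; rewrite EFinM nnfun_muleindic_ge0.
under [RHS]eq_integral.
  move=> x xD; rewrite fimfunE -fsumEFin// ge0_mule_fsuml; last first.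
    by move=> r; rewrite EFinM nnfun_muleindic_ge0.
  over.
rewrite [RHS]ge0_integral_fsum//; last 2 first.
  - move=> r; apply: emeasurable_funM => //.
    by apply/measurable_EFinP; exact/measurableT_comp.
  - by move=> n x _; rewrite mule_ge0//; rewrite nnfun_muleindic_ge0.
apply: eq_fsbigr => r _; rewrite integralZl_indic_nnsfun//= integral_indic// setIT.
rewrite nug; last exact: measurable_funPTI.
under [RHS]eq_integral do rewrite EFinM -muleA.
have [r0|r0] := ltP r 0%R.
  rewrite (preimage_nnfun0 _ r0) integral_set0 mule0.
  by under eq_integral do rewrite indicE in_set0 mul0e mule0; rewrite integral0.
rewrite ge0_integralZl//.
- congr (_ * _); rewrite integral_mkcond; apply: eq_integral => x _.
  by rewrite patchE indicE; case: ifPn => _; rewrite ?mul1e ?mul0e.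
- apply: emeasurable_funM => //; apply/measurable_EFinP.
  by apply: measurable_indic; exact: measurable_funPTI.
- by move=> x _; rewrite mule_ge0// lee_fin.
Qed.

Lemma ge0_integral_density (f : T -> \bar R) :
  measurable_fun setT f -> (forall x, 0 <= f x) ->
  \int[nu]_x f x = \int[mu]_x (f x * g x).
Proof.
move=> mf f0.
pose f_ := nnsfun_approx measurableT mf.
have fnf x : (f_ n x)%:E @[n --> \oo] --> f x by exact: cvg_nnsfun_approx.
transitivity (limn (fun n => \int[nu]_x (f_ n x)%:E)).
  rewrite -monotone_convergence//=.
  - by apply: eq_integral => x _; apply/esym/cvg_lim.
  - by move=> n; exact/measurable_EFinP.
  - by move=> n ? _; rewrite lee_fin.
  - by move=> ? _ ? ? mn; rewrite lee_fin; exact/lefP/nd_nnsfun_approx.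
transitivity (limn (fun n => \int[mu]_x ((f_ n x)%:E * g x))).
  by apply: congr_lim; apply/funext => n; exact: density_nnsfun.
rewrite -monotone_convergence//=.
- apply: eq_integral => x _; apply/cvg_lim => //.
  by rewrite -(fineK (gfin x)); apply: cvgeZr.
- by move=> n; apply: emeasurable_funM => //; exact/measurable_EFinP.
- by move=> n ? _; rewrite mule_ge0// lee_fin.
- move=> x _ a b ab; apply: lee_wpmul2r => //.
  by rewrite lee_fin; exact/lefP/nd_nnsfun_approx.
Qed.

End density.

Section restricted_law.
Local Open Scope ereal_scope.
Context {d : measure_display} {T : measurableType d} {R : realType}.
Variables (P : probability T R) (E : set T) (mE : measurable E).
Variables (X : {mfun T >-> R}) (r : {nonneg R}).

Definition restricted_push : set R -> \bar R := pushforward (mrestr P mE) X.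

Let restricted_push0 : restricted_push set0 = 0.
Proof. exact: measure0. Qed.

Let restricted_push_ge0 A : 0 <= restricted_push A.
Proof. exact: measure_ge0. Qed.

Let restricted_push_sigma_additive : semi_sigma_additive restricted_push.
Proof. exact: measure_semi_sigma_additive. Qed.

HB.instance Definition _ := isMeasure.Build _ _ _ restricted_push
  restricted_push0 restricted_push_ge0 restricted_push_sigma_additive.

(** A finite measure rather than a probability, so that product measures and Fubini apply on an
    event such as a given transition of the chain. *)
Definition restricted_law : set R -> \bar R := mscale r restricted_push.

HB.instance Definition _ := Measure.on restricted_law.

Let restricted_law_fin : fin_num_fun restricted_law.
Proof.
move=> A mA; rewrite /restricted_law /mscale/= fin_numM//.
rewrite /pushforward /mrestr fin_num_measure//.
exact: measurable_funPTI.
Qed.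

HB.instance Definition _ := @Measure_isFinite.Build _ _ _ restricted_law restricted_law_fin.

Lemma ge0_integral_mrestr (f : T -> \bar R) : measurable_fun setT f ->
  (forall x, 0 <= f x) -> \int[mrestr P mE]_x f x = \int[P]_(x in E) f x.
Proof.
move=> mf f0; rewrite (@ge0_integral_density _ _ _ P (mrestr P mE) (EFin \o \1_E))//.
- rewrite [RHS]integral_mkcond; apply: eq_integral => x _.
  by rewrite patchE /= indicE; case: ifPn => _; rewrite ?mule1 ?mule0.
- by apply/measurable_EFinP; exact: measurable_indic.
- by move=> x; rewrite lee_fin.
- by move=> A mA; rewrite integral_indic// setIC.
Qed.

Lemma integral_restricted_law (f : R -> \bar R) : measurable_fun setT f ->
  (forall x, 0 <= f x) ->
  \int[restricted_law]_x f x = r%:num%:E * \int[P]_(w in E) f (X w).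
Proof.
move=> mf f0; rewrite ge0_integral_mscale//; congr (_ * _).
rewrite ge0_integral_pushforward//= preimage_setT ge0_integral_mrestr//.
exact: measurableT_comp.
Qed.

End restricted_law.

(** By uniqueness of product measures, the law of the pair (X, S) on F is the product of r times the
    law of X on E with rho; Fubini concludes. It serves for a jump of the chain, with r the
    transition probability, and for the independence of G and tau, with r = 1. *)
Lemma integral_add_indep {d : measure_display} {T : measurableType d} {R : realType}
    (P : probability T R) (E F : set T) (X S : {mfun T >-> R})
    (rho : probability R R) (r : {nonneg R}) (phi : R -> \bar R) :
  measurable E -> measurable F ->
  (forall A B, measurable A -> measurable B ->
    P (F `&` (X @^-1` A `&` S @^-1` B)) = (r%:num%:E * P (E `&` X @^-1` A) * rho B)%E) ->
  measurable_fun setT phi -> (forall x, 0 <= phi x)%E ->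
  (\int[P]_(w in F) phi (X w + S w)%R =
   r%:num%:E * \int[P]_(w in E) \int[rho]_s phi (X w + s)%R)%E.
Proof.
move=> mE mF h mphi phi0.
pose XS (w : T) : R * R := (X w, S w).
have mXS : measurable_fun setT XS by apply: measurable_fun_pair.
pose f (z : R * R) := phi (z.1 + z.2).
have mf : measurable_fun setT f.
  apply: measurableT_comp => //; apply: measurable_funD => //.
have mfphi : measurable_fun setT (fun x : R => \int[rho]_s phi (x + s)%R)%E.
  by apply: (@measurable_fun_fubini_tonelli_F _ _ R R R rho f) => // x; exact: phi0.
rewrite -(@ge0_integral_mrestr _ _ _ P F mF (fun w => f (XS w))); last 2 first.
- exact: measurableT_comp.
- by move=> x; exact: phi0.
have f0 : {in setT, forall z, 0 <= f z}%E by move=> z _; exact: phi0.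
rewrite -[LHS](ge0_integral_pushforward mXS (mrestr P mF) measurableT mf f0).
rewrite -(integral_restricted_law P mE X r mfphi); last first.
  by move=> x; apply: integral_ge0.
rewrite -[RHS]/(\int[restricted_law P mE X r]_x fubini_F rho f x)%E.
rewrite -fubini_tonelli1//; last by move=> z; exact: phi0.
apply: eq_measure_integral => A mA _.
apply/esym; apply: product_measure_unique => // B C mB mC.
rewrite -[RHS]/((r%:num%:E * P (X @^-1` B `&` E)) * rho C)%E (setIC _ E) -h//.
by rewrite /pushforward /mrestr setIC.
Qed.

Section exponential_law.
Context {R : realType}.

(* The library's measure lives on the copy [measurableTypeR R] of [R]. *)
Let idTR : measurableTypeR R -> R := idfun.

#[local] HB.instance Definition _ :=
  @isMeasurableFun.Build _ _ _ _ idTR (@measurable_id _ _ setT).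

Definition exponential_law (rate : R) (r0 : 0 < rate) : probability R R :=
  distribution
    (exponential_distribution_exponential_prob__canonical__probability_measure_Probability r0)
    idTR.

Lemma exponential_lawE (rate : R) (r0 : 0 < rate) :
  exponential_law r0 = exponential_prob rate :> (set R -> \bar R).
Proof. by []. Qed.

Lemma ge0_integral_exponential (rate : R) (r0 : 0 < rate) (f : R -> \bar R) :
  measurable_fun setT f -> (forall x, 0 <= f x)%E ->
  (\int[exponential_law r0]_x f x =
   \int[lebesgue_measure]_x (f x * (exponential_pdf rate x)%:E))%E.
Proof.
move=> mf f0; rewrite ge0_integral_distribution//.
apply: (@ge0_integral_density _ (measurableTypeR R) _ lebesgue_measure _
  (EFin \o exponential_pdf rate)) => //.
- by apply/measurable_EFinP; exact: measurable_exponential_pdf.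
- by move=> x; rewrite lee_fin exponential_pdf_ge0// ltW.
Qed.

End exponential_law.

(** * Void probabilities of the M/M/infinity queue *)

Section mminf.
Context {R : realType}.
Variable c : R.
Hypothesis c0 : 0 < c.

(* The probability that an M/M/infinity queue started from n is empty at time y;
   a Poisson number with mean c (1 - e^-y) of the later arrivals is still there. *)
Definition mminf_void (n : nat) (y : R) : R :=
  (1 - expR (- y)) ^+ n * expR (- (c * (1 - expR (- y)))).

Lemma mminf_void0 (y : R) : mminf_void 0 y = mminf_return c y.
Proof. by rewrite /mminf_void expr0 mul1r. Qed.

Lemma mminf_void_ge0 (n : nat) (y : R) : 0 <= y -> 0 <= mminf_void n y.
Proof.
move=> y0; rewrite /mminf_void mulr_ge0 ?expR_ge0// exprn_ge0// subr_ge0.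
by rewrite -expR0 ler_expR oppr_le0.
Qed.

Lemma mminf_void_le1 (n : nat) (y : R) : 0 <= y -> mminf_void n y <= 1.
Proof.
move=> y0; have h : 0 <= 1 - expR (- y) <= 1.
  by rewrite gerBl expR_ge0 andbT subr_ge0 -expR0 ler_expR oppr_le0.
case/andP: h => h1 h2.
rewrite /mminf_void -[leRHS]mul1r ler_pM ?expR_ge0 ?exprn_ge0 ?exprn_ile1//.
by rewrite -[leRHS]expR0 ler_expR oppr_le0 mulr_ge0// ltW.
Qed.

(** The backward Kolmogorov equation of the queue. *)
Lemma is_derive_mminf_void (n : nat) (y : R) :
  is_derive y (1 : R) (mminf_void n)
   (c * mminf_void n.+1 y + n%:R * mminf_void n.-1 y - (c + n%:R) * mminf_void n y).
Proof.
pose x (z : R) := 1 - expR (- z).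
have dx : is_derive y (1 : R) x (expR (- y)).
  have d1 := is_derive1_comp (is_derive_expR (- y)) (is_deriveNid y 1).
  have h := is_deriveB (is_derive_cst (1 : R) y 1) d1.
  by apply: (is_derive_eq h); rewrite mulrN1 sub0r opprK.
have dE : is_derive y (1 : R) (fun z => expR (- (c * x z))) (- (c * expR (- y)) * expR (- (c * x y))).
  have d2 : is_derive y (1 : R) (fun z => - (c * x z)) (- (c * expR (- y))).
    exact: is_deriveN (is_deriveZ c dx).
  have h := @is_derive1_comp R expR (fun z => - (c * x z)) y _ _ (is_derive_expR _) d2.
  by apply: (is_derive_eq h); rewrite mulrC.
have h := is_deriveM (is_deriveX n dx) dE.
have xn z : (x ^+ n) z = x z ^+ n.
  by elim: n {h} => [//|k IH]; rewrite !exprS -IH.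
rewrite [X in is_derive _ _ X](_ : _ = x ^+ n * (fun z => expR (- (c * x z)))); last first.
  by apply/funext => z; rewrite /mminf_void -/(x z) -xn.
apply: (is_derive_eq h); rewrite xn.
have e : expR (- y) = 1 - x y by rewrite /x opprB addrC subrK.
rewrite /mminf_void -/(x y) /GRing.scale/= e.
move: (expR (- (c * x y))) (x y) => E X.
by case: n h xn => [|n] _ _ /=; rewrite ?exprS; ring.
Qed.

Lemma continuous_mminf_void (n : nat) : continuous (mminf_void n).
Proof.
move=> y; apply: differentiable_continuous; apply/derivable1_diffP.
by have [] := is_derive_mminf_void n y.
Qed.

(** Decomposition at the first jump. By the backward equation the integrand is the derivative of F
    below, and the boundary term at s = y vanishes because a queue started from n + 1 customers is
    not empty at time 0. *)
Lemma mminf_void_renewal (n : nat) (y : R) : 0 <= y ->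
  (\int[lebesgue_measure]_(s in `[0%R, y])
    (expR (- (c + n.+1%:R) * s) *
     (c * mminf_void n.+2 (y - s) + n.+1%:R * mminf_void n (y - s)))%:E =
   (mminf_void n.+1 y)%:E)%E.
Proof.
rewrite le_eqVlt => /predU1P[<-|y0].
  rewrite set_itv1 integral_set1 /mminf_void oppr0 expR0 subrr expr0n mul0r.
  by [].
pose F s := - (expR (- (c + n.+1%:R) * s) * mminf_void n.+1 (y - s)).
have dF s : is_derive s (1 : R) F (expR (- (c + n.+1%:R) * s) *
     (c * mminf_void n.+2 (y - s) + n.+1%:R * mminf_void n (y - s))).
  have d0 : is_derive s (1 : R) (fun s => y - s) (-1).
    have h := is_deriveB (is_derive_cst y s 1) (is_derive_id s (1 : R)).
    by apply: (is_derive_eq h); rewrite sub0r.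
  have d1 := @is_derive1_comp R (mminf_void n.+1) (fun s => y - s) s _ _
    (is_derive_mminf_void _ _) d0.
  have d2 := @is_derive1_comp R expR (fun s => - (c + n.+1%:R) * s) s _ _
    (is_derive_expR _) (is_deriveZ (- (c + n.+1%:R)) (is_derive_id s (1 : R))).
  have h := is_deriveN (is_deriveM d2 d1).
  by apply: (is_derive_eq h); rewrite /GRing.scale/=; ring.
have cF : continuous F.
  move=> s; apply: differentiable_continuous; apply/derivable1_diffP.
  by have [] := dF s.
rewrite (@continuous_FTC2 _ _ F)//.
- rewrite /F subr0 mulr0 expR0 mul1r subrr -EFinD opprK.
  rewrite {1}/mminf_void oppr0 expR0 subrr expr0n mul0r mulr0 oppr0 add0r.
  by [].
- apply: continuous_subspaceT => s.
  apply: cvgM.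
    apply: continuous_comp; last exact: continuous_expR.
    by apply: cvgM; [exact: cvg_cst|exact: cvg_id].
  have cv k : mminf_void k (y - z) @[z --> s] --> mminf_void k (y - s).
    apply: (@continuous_comp _ _ _ (fun z => y - z) (mminf_void k)).
      by apply: cvgB; [exact: cvg_cst|exact: cvg_id].
    exact: continuous_mminf_void.
  by apply: cvgD; (apply: cvgM; [exact: cvg_cst|exact: cv]).
- split.
  + by move=> s _; have [] := dF s.
  + by apply: cvg_at_right_filter; exact: cF.
  + by apply: cvg_at_left_filter; exact: cF.
- by move=> s _; rewrite derive1E; have [_] := dF s.
Qed.

End mminf.

Lemma measurable_fun_nat_comp {d : measure_display} {T : measurableType d} {R : realType}
    (N : {mfun T >-> nat}) (X : {mfun T >-> R}) (f : nat -> R -> \bar R) :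
  (forall n, measurable_fun setT (f n)) ->
  measurable_fun setT (fun w => f (N w) (X w)).
Proof.
move=> mf.
have -> : [set: T] = \bigcup_n (N @^-1` [set n]).
  by apply/seteqP; split=> // w _; exists (N w).
apply/measurable_fun_bigcup => n; first exact: measurable_funPTI.
apply: (eq_measurable_fun (fun w => f n (X w))).
  by move=> w; rewrite inE/= => ->.
by apply: measurable_funTS; exact: measurableT_comp.
Qed.

(** * The jump chain up to its first visit to 0 *)

Section jump_chain.
Context {d : measure_display} {T : measurableType d} {R : realType}.
Variables (P : probability T R) (c : R) (pi0 : nat -> R).
Variables (Y : nat -> {RV P >-> nat}) (S : nat -> {RV P >-> R}).
Hypothesis c0 : 0 < c.
Hypothesis pi0_ge0 : forall n, 0 <= pi0 n.

Let jp (i j : nat) : R := jump_prob (fun=> c) (fun n => n%:R) i j.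

Hypothesis YS : forall (n : nat) (i : nat -> nat) (A : nat -> set R),
  (forall k, measurable (A k)) ->
  P (\bigcap_(k in [set k | (k <= n)%N]) (Y k @^-1` [set i k] `&` S k @^-1` A k)) =
  ((pi0 (i 0%N))%:E * (\prod_(0 <= k < n) jp (i k) (i k.+1))%:E
   * \prod_(0 <= k < n.+1) exponential_prob (c + (i k)%:R) (A k))%E.

Let rate_gt0 (n : nat) : 0 < c + n%:R.
Proof. by rewrite ltr_wpDr. Qed.

Let jp_ge0 i j : 0 <= jp i j.
Proof.
rewrite /jp /jump_prob; case: ifP => _; first by rewrite divr_ge0// ltW.
by case: ifP => _ //; rewrite divr_ge0// ltW.
Qed.

Let cyl (k : nat) (i : nat -> nat) (A : nat -> set R) : set T :=
  \bigcap_(j in [set j | (j < k)%N]) (Y j @^-1` [set i j] `&` S j @^-1` A j).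

Let cyls (k : nat) : set (set T) :=
  [set X | exists i A, (forall j, measurable (A j)) /\ X = cyl k i A].

Let measurable_cyl k i A : (forall j, measurable (A j)) -> measurable (cyl k i A).
Proof.
move=> mA; apply: bigcap_measurableType => j _.
by apply: measurableI; exact: measurable_funPTI.
Qed.

Let past_measurable (k : nat) (phi : pred (seq nat)) (A : nat -> set R) :
  (forall j, measurable (A j)) ->
  <<s cyls k >> [set w | phi (mkseq (fun j => Y j w) k) /\ forall j, (j < k)%N -> A j (S j w)].
Proof.
move=> mA.
rewrite (_ : [set w | _] = \bigcup_s (if (size s == k) && phi s then cyl k (nth 0%N s) A else set0)).
  apply: (@countable_bigcupT_measurable _ (g_sigma_algebraType (cyls k))); first exact: countableP.
  move=> s; case: ifP => _; last exact: measurable0.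
  by apply: sub_sigma_algebra; exists (nth 0%N s), A.
apply/seteqP; split=> w /=.
  move=> [h1 h2]; exists (mkseq (fun j => Y j w) k) => //.
  rewrite size_mkseq eqxx h1/= => j /= jk; split; last exact: h2.
  by rewrite /= nth_mkseq.
move=> [s _]; case: ifP => // /andP[/eqP sk h] hw; split.
  rewrite (_ : mkseq _ _ = s)//; apply: (@eq_from_nth _ 0%N); rewrite size_mkseq// => j jk.
  by rewrite nth_mkseq//; have [] := hw j jk.
by move=> j jk; have [] := hw j jk.
Qed.

Definition arrival (k : nat) (w : T) : R := \sum_(0 <= j < k) S j w.

Lemma arrivalS k w : arrival k.+1 w = arrival k w + S k w.
Proof. by rewrite /arrival big_nat_recr. Qed.

Let measurable_arrival k : measurable_fun setT (arrival k).
Proof. by apply: measurable_sum => j. Qed.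

HB.instance Definition _ k := isMeasurableFun.Build _ _ _ _ (arrival k) (measurable_arrival k).

Definition alive (k : nat) : set T := [set w | forall j, (j < k)%N -> (0 < Y j w)%N].

Let past_arrival (k : nat) (A : set R) : measurable A ->
  <<s cyls k >> (alive k `&` arrival k @^-1` A).
Proof.
move=> mA; apply: (@measurableI _ (g_sigma_algebraType (cyls k))).
  have := @past_measurable k (all (leq 1)) (fun=> setT) (fun=> measurableT).
  congr (<<s cyls k >> _); apply/seteqP; split=> w /=.
    move=> [/allP h _] j jk; apply: h; apply/mapP; exists j => //.
    by rewrite mem_iota.
  by move=> h; split => //; apply/allP => _ /mapP[j + ->]; rewrite mem_iota => /h.
have h l : (l <= k)%N ->
    @measurable_fun _ _ (g_sigma_algebraType (cyls k)) R setT (arrival l).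
  elim: l => [_|l IH lk].
    rewrite (_ : arrival 0 = cst 0); first exact: measurable_cst.
    by apply/funext => w; rewrite /arrival big_geq.
  rewrite (_ : arrival l.+1 = arrival l \+ S l); last first.
    by apply/funext => w; rewrite arrivalS.
  apply: (@measurable_funD _ (g_sigma_algebraType (cyls k))).
    exact: IH (ltnW lk).
  move=> _ B mB; rewrite setTI.
  have := @past_measurable k predT (fun j => if j == l then B else setT)
    (fun j => match j == l as b return measurable (if b then B else setT) with true => mB | false => measurableT end).
  congr (<<s cyls k >> _); apply/seteqP; split=> w /=.
    by move=> [_ /(_ l lk)]; rewrite eqxx.
  by move=> hw; split => // j _; case: eqP => // ->.
by have := h k (leqnn k) measurableT A mA; rewrite setTI.
Qed.

(** The hypothesis [YS] speaks of rectangles only. Uniqueness of measures on the pi-system of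
    cylinders extends it to every event of the first k steps, in particular to those involving the
    sum [arrival k]. *)
Let transition_indep (k n n' : nat) (B : set R) (X : set T) : measurable B ->
  <<s cyls k >> X ->
  P (X `&` (Y k @^-1` [set n] `&` (S k @^-1` B `&` Y k.+1 @^-1` [set n']))) =
  ((jp n n')%:E * P (X `&` Y k @^-1` [set n]) * exponential_prob (c + n%:R) B)%E.
Proof.
move=> mB sX.
have mE1 : measurable (Y k @^-1` [set n]) by exact: measurable_funPTI.
have mE2 : measurable (Y k @^-1` [set n] `&` (S k @^-1` B `&` Y k.+1 @^-1` [set n'])).
  by apply: measurableI => //; apply: measurableI; exact: measurable_funPTI.
have efin : exponential_prob (c + n%:R) B \is a fin_num.
  exact: (fin_num_measure (exponential_law (rate_gt0 n)) _ mB).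
have r0 : 0 <= jp n n' * fine (exponential_prob (c + n%:R) B).
  by rewrite mulr_ge0// fine_ge0// -(exponential_lawE (rate_gt0 n)).
pose r := NngNum r0.
(* The uniqueness theorem wants a countable cover by cylinders: one for each finite list of states,
   enumerated by [unpickle]. *)
have := @g_sigma_algebra_measure_unique _ R T (cyls k) _
  (fun j => cyl k (nth 0%N (odflt [::] (unpickle j : option (seq nat)))) (fun=> setT)) _ _
  (mrestr P mE2) (mscale r (mrestr P mE1)) _ _ _ X sX.
move=> e; rewrite -[LHS]/(mrestr P mE2 X) e {e}.
- rewrite -[LHS]/((jp n n' * fine (exponential_prob (c + n%:R) B))%:E * P (X `&` Y k @^-1` [set n]))%E.
  by rewrite EFinM fineK// -!muleA [(exponential_prob _ _ * _)%E]muleC.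
- by move=> _ [i [A [mA ->]]]; exact: measurable_cyl.
- by move=> j; exists (nth 0%N (odflt [::] (unpickle j))), (fun=> setT).
- apply/seteqP; split => // w _.
  exists (pickle (mkseq (fun j => Y j w) k)) => //; rewrite pickleK => j jk.
  by split => //; rewrite /= nth_mkseq.
- move=> _ _ [i [A [mA ->]]] [i' [A' [mA' ->]]].
  exists i, (fun j => if i j == i' j then A j `&` A' j else set0); split.
    by move=> j; case: ifP => _ //; exact: measurableI.
  apply/seteqP; split=> w /=.
    move=> [h h'] j jk; have [Yj Sj] := h j jk; have [Yj' Sj'] := h' j jk.
    by rewrite /= in Yj Yj'; rewrite -Yj -Yj' eqxx.
  move=> h; split=> j jk; have [/= Yj] := h j jk; case: eqP => // e [Sj Sj'] //.
  by split => //=; rewrite -e.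
- move=> _ [i [A [mA ->]]].
  pose i2 j := if (j < k)%N then i j else if j == k then n else n'.
  pose A1 j := if (j < k)%N then A j else setT.
  pose A2 j := if (j < k)%N then A j else if j == k then B else setT.
  have mA1 j : measurable (A1 j) by rewrite /A1; case: ifP.
  have mA2 j : measurable (A2 j) by rewrite /A2; case: ifP => // _; case: ifP.
  have e1 : cyl k i A `&` Y k @^-1` [set n] =
      \bigcap_(j in [set j | (j <= k)%N]) (Y j @^-1` [set i2 j] `&` S j @^-1` A1 j).
    apply/seteqP; split=> w /=.
      move=> [h hk] j; rewrite /= leq_eqVlt /i2 /A1 => /predU1P[->|jk].
        by rewrite ltnn eqxx; split.
      by rewrite jk; exact: h.
    move=> h; split; last by have [] := h k (leqnn k); rewrite /i2 /= ltnn eqxx.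
    by move=> j jk; have := h j (ltnW jk); rewrite /i2 /A1 jk.
  have e2 : cyl k i A `&` (Y k @^-1` [set n] `&` (S k @^-1` B `&` Y k.+1 @^-1` [set n'])) =
      \bigcap_(j in [set j | (j <= k.+1)%N]) (Y j @^-1` [set i2 j] `&` S j @^-1` A2 j).
    have k1 : (k.+1 < k)%N = false by rewrite ltnNge leqnSn.
    have k2 : (k.+1 == k) = false by rewrite gtn_eqF.
    apply/seteqP; split=> w /=.
      move=> [h [hk [hS hk']]] j; rewrite /= leq_eqVlt ltnS leq_eqVlt /i2 /A2.
      move=> /predU1P[->|/predU1P[->|jk]]; first by rewrite k1 k2.
        by rewrite ltnn eqxx.
      by rewrite jk; exact: h.
    move=> h; split; first by move=> j jk; have := h j (leqW (ltnW jk)); rewrite /i2 /A2 jk.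
    have := h k (leqnSn k); have := h k.+1 (leqnn _); rewrite /i2 /A2/= k1 k2 ltnn eqxx.
    by move=> [? _] [? ?].
  rewrite -[LHS]/(P (cyl k i A `&` (Y k @^-1` [set n] `&` (S k @^-1` B `&` Y k.+1 @^-1` [set n'])))).
  rewrite -[RHS]/((jp n n' * fine (exponential_prob (c + n%:R) B))%:E * P (cyl k i A `&` Y k @^-1` [set n]))%E.
  rewrite e1 e2 !YS//.
  have eT : exponential_prob (c + n'%:R) setT = 1%E.
    exact: (probability_setT (exponential_law (rate_gt0 n'))).
  have eT' : exponential_prob (c + n%:R) setT = 1%E.
    exact: (probability_setT (exponential_law (rate_gt0 n))).
  rewrite (big_nat_recr k _ (fun k0 => jp (i2 k0) (i2 k0.+1)))//.
  rewrite (big_nat_recr k.+1 _ (fun k0 => exponential_prob (c + (i2 k0)%:R) (A2 k0)))//.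
  rewrite (big_nat_recr k _ (fun k0 => exponential_prob (c + (i2 k0)%:R) (A2 k0)))//.
  rewrite (big_nat_recr k _ (fun k0 => exponential_prob (c + (i2 k0)%:R) (A1 k0)))//=.
  have ik : i2 k = n by rewrite /i2 ltnn eqxx.
  have ik' : i2 k.+1 = n' by rewrite /i2 ltnNge leqnSn/= gtn_eqF.
  have Ak : A2 k = B by rewrite /A2 ltnn eqxx.
  have Ak' : A2 k.+1 = setT by rewrite /A2 ltnNge leqnSn/= gtn_eqF.
  have Ak1 : A1 k = setT by rewrite /A1 ltnn.
  rewrite ik ik' Ak Ak' Ak1 eT eT' !mule1.
  rewrite [in LHS](@eq_big_nat _ _ _ _ _ _ (fun j => exponential_prob (c + (i2 j)%:R) (A1 j))); last first.
    by move=> j /andP[_ jk]; rewrite /A1 /A2 jk.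
  rewrite !EFinM fineK// (muleC (jp n n')%:E) -!muleA.
  rewrite [RHS]muleC -!muleA [RHS]muleCA; congr (_ * _)%E.
  by rewrite [RHS]muleCA.
- move=> j; rewrite -ge0_fin_numE//; apply: fin_num_measure.
  exact: measurable_cyl.
Qed.

Let measurable_alive k : measurable (alive k).
Proof.
rewrite (_ : alive k = \bigcap_(j in [set j | (j < k)%N]) (Y j @^-1` [set n | (0 < n)%N])).
  by apply: bigcap_measurableType => j _; exact: measurable_funPTI.
by apply/seteqP; split.
Qed.

Let aliveS k : alive k.+1 = alive k `&` Y k @^-1` [set n | (0 < n)%N].
Proof.
apply/seteqP; split=> w /=.
  by move=> h; split; [move=> j jk; exact: h (ltnW jk)|exact: h].
by move=> [h hk] j; rewrite ltnS leq_eqVlt => /predU1P[->|/h].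
Qed.

Let transition_integral (k n n' : nat) (phi : R -> \bar R) :
  measurable_fun setT phi -> (forall x, 0 <= phi x)%E ->
  (\int[P]_(w in alive k `&` Y k @^-1` [set n] `&` Y k.+1 @^-1` [set n']) phi (arrival k.+1 w) =
   (jp n n')%:E * \int[P]_(w in alive k `&` Y k @^-1` [set n])
      \int[exponential_law (rate_gt0 n)]_s phi (arrival k w + s)%R)%E.
Proof.
move=> mphi phi0.
under eq_integral do rewrite arrivalS.
apply: (@integral_add_indep _ _ _ P _ _ (arrival k) (S k) _ (NngNum (jp_ge0 n n'))) => //.
- by apply: measurableI => //; exact: measurable_funPTI.
- by apply: measurableI; [apply: measurableI => //|]; exact: measurable_funPTI.
move=> A B mA mB.
have := @transition_indep k n n' B _ mB (@past_arrival k A mA).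
rewrite exponential_lawE/= => h.
rewrite [X in (_ * P X * _)%E](_ : _ = alive k `&` arrival k @^-1` A `&` Y k @^-1` [set n]); last first.
  by rewrite -!setIA [arrival k @^-1` A `&` _]setIC.
rewrite -[RHS]h; congr (P _).
apply/seteqP; split=> w /=; first by move=> [[[? ?] ?] [? ?]].
by move=> [[? ?] [? [? ?]]].
Qed.

Definition stopped_mean (k : nat) (f : nat -> R -> \bar R) : \bar R :=
  (\int[P]_(w in alive k) f (Y k w) (arrival k w))%E.

(** The transition operator of the Markov chain formed by the state and the time at which it is
    entered. *)
Definition jump_op (f : nat -> R -> \bar R) (n : nat) (a : R) : \bar R :=
  ((jp n n.+1)%:E * \int[exponential_law (rate_gt0 n)]_s f n.+1 (a + s)%R +
   (jp n n.-1)%:E * \int[exponential_law (rate_gt0 n)]_s f n.-1 (a + s)%R)%E.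

(** The event [alive k.+1] constrains the states up to step k only, so the next state is free and
    the Markov property applies. After splitting by the values at steps k and k + 1, only the two
    neighbours of the current state contribute. *)
Lemma stopped_meanS (k : nat) (f : nat -> R -> \bar R) :
  (forall n, measurable_fun setT (f n)) -> (forall n a, 0 <= f n a)%E ->
  stopped_mean k.+1 f = (\int[P]_(w in alive k.+1) jump_op f (Y k w) (arrival k w))%E.
Proof.
move=> mf f0.
have mI (n : nat) (g : R -> \bar R) : measurable_fun setT g -> (forall a, 0 <= g a)%E ->
    measurable_fun setT (fun a : R => (\int[exponential_law (rate_gt0 n)]_s g (a + s)%R)%E).
  move=> mg g0; pose g2 (z : R * R) := g (z.1 + z.2).
  apply: (@measurable_fun_fubini_tonelli_F _ _ R R R _ g2) => [|x]; last exact: g0.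
  by apply: measurableT_comp => //; exact: measurable_funD.
have mIw (n : nat) (g : R -> \bar R) : measurable_fun setT g -> (forall a, 0 <= g a)%E ->
    measurable_fun setT (fun w => (\int[exponential_law (rate_gt0 n)]_s g (arrival k w + s)%R)%E).
  move=> mg g0; pose h (a : R) := (\int[exponential_law (rate_gt0 n)]_s g (a + s)%R)%E.
  by apply: (@measurableT_comp _ _ _ _ _ _ h); [exact: mI|].
have mj n : measurable_fun setT (jump_op f n).
  by apply: emeasurable_funD; apply: measurable_funeM; exact: mI.
have j0 n a : (0 <= jump_op f n a)%E.
  by apply: adde_ge0; rewrite mule_ge0 ?lee_fin//; exact: integral_ge0.
have mA n : measurable (alive k.+1 `&` Y k @^-1` [set n]).
  by apply: measurableI => //; exact: measurable_funPTI.
have cover : alive k.+1 = \bigcup_n (alive k.+1 `&` Y k @^-1` [set n]).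
  by apply/seteqP; split=> [w h|w [n _ []]//]; exists (Y k w).
have tr : trivIset setT (fun n => alive k.+1 `&` Y k @^-1` [set n]).
  by apply/trivIsetP => i j _ _ /eqP ij; apply/seteqP; split=> // w /= [[_ ->] [_]].
rewrite /stopped_mean cover ge0_integral_bigcup//; last first.
  by apply: measurable_funTS; exact: measurable_fun_nat_comp.
rewrite [RHS]ge0_integral_bigcup//; last first.
  by apply: measurable_funTS; exact: measurable_fun_nat_comp.
apply: eq_eseriesr => -[|n] _.
  rewrite (_ : _ `&` _ = set0) ?integral_set0//.
  by apply/seteqP; split => // w [/(_ k (leqnn _)) /= + /=]; move=> + e; rewrite e.
have en : alive k.+1 `&` Y k @^-1` [set n.+1] = alive k `&` Y k @^-1` [set n.+1].
  by rewrite aliveS; apply/seteqP; split=> w /=; [move=> [[]]|move=> [? ->]].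
rewrite en.
have mE : measurable (alive k `&` Y k @^-1` [set n.+1]) by rewrite -en.
rewrite [RHS](eq_integral (fun w => jump_op f n.+1 (arrival k w))); last first.
  by move=> w; rewrite inE => -[_ /= ->].
rewrite ge0_integralD//; last 4 first.
- by move=> w _; rewrite mule_ge0 ?lee_fin//; exact: integral_ge0.
- by apply: measurable_funTS; apply: measurable_funeM; exact: mIw.
- by move=> w _; rewrite mule_ge0 ?lee_fin//; exact: integral_ge0.
- by apply: measurable_funTS; apply: measurable_funeM; exact: mIw.
have pos n' (w : T) : (0 <= \int[exponential_law (rate_gt0 n.+1)]_s f n' (arrival k w + s)%R)%E.
  exact: integral_ge0.
rewrite [in RHS]ge0_integralZl ?lee_fin//; last by apply: measurable_funTS; exact: mIw.
rewrite [X in (_ + X)%E]ge0_integralZl ?lee_fin//; last by apply: measurable_funTS; exact: mIw.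
rewrite -!transition_integral//.
have cov2 : alive k `&` Y k @^-1` [set n.+1] =
    \bigcup_n' (alive k `&` Y k @^-1` [set n.+1] `&` Y k.+1 @^-1` [set n']).
  by apply/seteqP; split=> [w h|w [n' _ []]//]; exists (Y k.+1 w).
rewrite {1}cov2 ge0_integral_bigcup//; last 3 first.
- by move=> n'; apply: measurableI => //; exact: measurable_funPTI.
- by apply: measurable_funTS; exact: measurable_fun_nat_comp.
- apply/trivIsetP => i j _ _ /eqP ij; apply/seteqP; split=> // w /= [[_ ei] [_ ej]].
  by apply: ij; rewrite -ei -ej.
transitivity (\sum_(n' <oo) \int[P]_(w in alive k `&` Y k @^-1` [set n.+1] `&` Y k.+1 @^-1` [set n'])
   f n' (arrival k.+1 w))%E.
  apply: eq_eseriesr => n' _; apply: eq_integral => w; rewrite inE => -[_ /= ->].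
  by [].
have tpos n' : (0 <= \int[P]_(w in alive k `&` Y k @^-1` [set n.+1] `&` Y k.+1 @^-1` [set n'])
   f n' (arrival k.+1 w))%E by exact: integral_ge0.
rewrite (@nneseriesD1 _ _ n.+2)//; congr (_ + _)%E.
rewrite (@nneseriesD1 _ _ n)/=; last 2 first.
- by move=> *; exact: tpos.
- by rewrite ltn_eqF.
rewrite eseries0 ?adde0// => i _ /= /andP[i1 i2].
rewrite transition_integral// /jp /jump_prob (negbTE i1) eqSS eq_sym (negbTE i2).
by rewrite mul0e.
Qed.

Let jp_up n : jp n n.+1 = c / (c + n%:R).
Proof. by rewrite /jp /jump_prob eqxx. Qed.

Let jp_down n : jp n.+1 n = n.+1%:R / (c + n.+1%:R).
Proof. by rewrite /jp /jump_prob eqxx ltn_eqF// ltnW. Qed.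

(* Given state n at time a, the probability that the queue is empty at time t:
   along the jump chain stopped at 0 it is a martingale (jump_op_void_by). *)
Definition void_by (t : R) (n : nat) (a : R) : \bar R :=
  (if a <= t then mminf_void c n (t - a) else 0)%:E.

Lemma measurable_void_by (t : R) (n : nat) : measurable_fun setT (void_by t n).
Proof.
apply/measurable_EFinP; apply: measurable_fun_if => //=.
  exact: measurable_fun_ler.
apply: measurable_funTS.
have mB : measurable_fun setT (fun a : R => t - a) by exact: measurable_funB.
apply: (@measurableT_comp _ _ _ _ _ _ (mminf_void c n) _ _ _ mB).
apply: continuous_measurable_fun; exact: continuous_mminf_void.
Qed.

Lemma void_by_ge0 (t : R) (n : nat) (a : R) : (0 <= void_by t n a)%E.
Proof. by rewrite lee_fin; case: ifP => // h; rewrite mminf_void_ge0// subr_ge0. Qed.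

(** Against the exponential density the jump probabilities turn into the rates c and n + 1, which
    produces the integral of [mminf_void_renewal]. *)
Lemma jump_op_void_by (t : R) (n : nat) (a : R) : jump_op (void_by t) n.+1 a = void_by t n.+1 a.
Proof.
have r0 := rate_gt0 n.+1.
have mv k : measurable_fun setT (fun s : R => void_by t k (a + s)).
  by apply: (@measurableT_comp _ _ _ _ _ _ (void_by t k)); [exact: measurable_void_by|exact: measurable_funD].
have pdf0 (s : R) : (0 <= (exponential_pdf (c + n.+1%:R) s)%:E)%E.
  by rewrite lee_fin exponential_pdf_ge0// ltW.
have mpdf : measurable_fun setT (fun s : R => (exponential_pdf (c + n.+1%:R) s)%:E).
  by apply/measurable_EFinP; exact: measurable_exponential_pdf.
have mp k : measurable_fun setT (fun s : R => (void_by t k (a + s) * (exponential_pdf (c + n.+1%:R) s)%:E)%E).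
  exact: emeasurable_funM.
rewrite /jump_op !ge0_integral_exponential => [||x|//|x]; rewrite ?void_by_ge0//.
have vp k (s : R) : (0 <= void_by t k (a + s) * (exponential_pdf (c + n.+1%:R) s)%:E)%E.
  by rewrite mule_ge0// void_by_ge0.
have Zl k (r : R) : 0 <= r ->
    (r%:E * \int[lebesgue_measure]_x (void_by t k (a + x) * (exponential_pdf (c + n.+1%:R) x)%:E) =
     \int[lebesgue_measure]_x (r%:E * (void_by t k (a + x) * (exponential_pdf (c + n.+1%:R) x)%:E)))%E.
  by move=> ?; rewrite ge0_integralZl//; exact: mp.
rewrite (Zl _ _ (jp_ge0 _ _)) (Zl _ _ (jp_ge0 _ _)).
rewrite -ge0_integralD//; last 4 first.
- by move=> s _; rewrite mule_ge0// lee_fin.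
- by apply: measurable_funeM; exact: mp.
- by move=> s _; rewrite mule_ge0// lee_fin.
- by apply: measurable_funeM; exact: mp.
rewrite [RHS]/void_by.
transitivity (\int[lebesgue_measure]_(s in `[0%R, (t - a)%R])
    (expR (- (c + n.+1%:R) * s) *
     (c * mminf_void c n.+2 (t - a - s) + n.+1%:R * mminf_void c n (t - a - s)))%:E)%E; last first.
  case: ifPn => [at_|]; first by rewrite mminf_void_renewal// subr_ge0.
  by rewrite -ltNge => ta; rewrite set_itv_ge ?integral_set0// bnd_simp -ltNge subr_lt0.
rewrite [RHS]integral_mkcond; apply: eq_integral => s _.
rewrite patchE mem_setE/= in_itv/=; case: ifPn => [/andP[s0 sta]|].
  rewrite /void_by -lerBrDl sta exponential_pdfE// -!EFinM -EFinD; congr EFin.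
  rewrite jp_up jp_down !opprD !addrA; field.
  by rewrite nat1r gt_eqF.
rewrite -[point]/(0%E) negb_and => /orP[|]; rewrite -ltNge => h.
  by rewrite lt0_exponential_pdf// !mule0 adde0.
by rewrite /void_by -lerBrDl leNgt h/= !mul0e !mule0 adde0.
Qed.

Let jump_op_const (V : nat -> R) (n : nat) (a : R) :
  jump_op (fun n _ => (V n)%:E) n a = (jp n n.+1 * V n.+1 + jp n n.-1 * V n.-1)%:E.
Proof.
have Ic (v : R) : (\int[exponential_law (rate_gt0 n)]_s v%:E = v%:E)%E.
  rewrite integral_cst// -[RHS]mule1; congr (_ * _)%E.
  exact: (probability_setT (exponential_law (rate_gt0 n))).
by rewrite /jump_op !Ic.
Qed.

(* A Lyapunov function: V (n+1) - V n = 2 + B a^n, whose geometric part is only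
   needed below 3 c, where 2 n has no downward drift. *)
Let lyapunov : {V : nat -> R | [/\ forall n, 0 <= V n,
  exists2 K, 0 <= K & forall n, V n <= K * 2 ^+ n &
  forall n, jp n.+1 n.+2 * V n.+2 + jp n.+1 n * V n + 1 <= V n.+1]}.
Proof.
(* This a gives c a <= 1/2, hence n + 1 - c a >= 1/2; B is then taken so that B a^n >= 6 c for all n
   <= M, which includes every n with n + 1 < 3 c. *)
pose a : R := (1 + 2 * c)^-1.
have c2 : 0 < 1 + 2 * c by rewrite ltr_pwDl// mulr_ge0// ltW.
have a0 : 0 < a by rewrite invr_gt0.
have a1 : a <= 1 by rewrite invf_le1// lerDl mulr_ge0// ltW.
have ca : c * a <= 2^-1.
  by rewrite /a ler_pdivrMr// mulrDr mulr1 mulrA mulVf// mul1r lerDr invr_ge0.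
pose M := (Num.truncn (3 * c)).+1.
have [B B0 hB] : {B : R | 0 <= B & forall n, (n <= M)%N -> 6 * c <= B * a ^+ n}.
  exists (6 * c / a ^+ M); first by rewrite divr_ge0 ?exprn_ge0 ?mulr_ge0// ltW.
  move=> n nM; rewrite -mulrA ler_peMr ?mulr_ge0 ?(ltW c0)//.
  rewrite mulrC ler_pdivlMr ?exprn_gt0// mul1r.
  by apply: ler_wiXn2l => //; rewrite ltW.
pose V n : R := 2 * n%:R + B * \sum_(0 <= j < n) a ^+ j.
have VS n : V n.+1 = V n + (2 + B * a ^+ n).
  by rewrite /V big_nat_recr//= -natr1; ring.
exists V; split.
- move=> n; rewrite /V; apply: addr_ge0; first by rewrite mulr_ge0.
  apply: mulr_ge0 => //.
  by apply: sumr_ge0 => j _; rewrite exprn_ge0// ltW.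
- exists (2 + B); first by rewrite addr_ge0.
  elim=> [|n IH]; first by rewrite /V big_geq// !mulr0 addr0 expr0 mulr1 addr_ge0.
  rewrite VS exprS mulrCA mulr_natl mulr2n lerD//.
  rewrite -[leLHS]mulr1 ler_pM ?addr_ge0 ?mulr_ge0 ?exprn_ge0 ?(ltW a0)//.
    by rewrite lerD2l -[leRHS]mulr1 ler_wpM2l// exprn_ile1// ltW.
  by rewrite exprn_ege1// lerDl.
move=> n; rewrite jp_up jp_down.
have r0 := rate_gt0 n.+1.
rewrite -(ler_pM2l r0).
have -> : (c + n.+1%:R) * (c / (c + n.+1%:R) * V n.+2 + n.+1%:R / (c + n.+1%:R) * V n + 1) =
   c * V n.+2 + n.+1%:R * V n + (c + n.+1%:R).
  by field; rewrite nat1r gt_eqF.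
rewrite !VS exprS.
have bn : 0 <= B * a ^+ n by rewrite mulr_ge0// exprn_ge0// ltW.
have n1 : 1 <= n.+1%:R :> R by rewrite ler1n.
(* The drift condition, multiplied by the total rate and written with the increments 2 + B a^n. If n
   + 1 < 3 c, the last product is at least 6 c / 2 and pays for the deficit. *)
have h : 0 <= n.+1%:R - 3 * c + B * a ^+ n * (n.+1%:R - c * a).
  have [le3|lt3] := leP (3 * c) n.+1%:R.
    by rewrite addr_ge0 ?subr_ge0// mulr_ge0// subr_ge0 (le_trans ca)// (le_trans _ n1)// invf_le1// ler1n.
  have nM : (n <= M)%N.
    have /truncn_itv/andP[_ h] : 0 <= 3 * c by rewrite mulr_ge0// ltW.
    by rewrite ltnW// -(ltr_nat R) (lt_trans _ h)// (lt_trans _ lt3)// ltr_nat.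
  have Ba := hB _ nM.
  have : 6 * c * 2^-1 <= B * a ^+ n * (n.+1%:R - c * a).
    apply: ler_pM => //; first by rewrite mulr_ge0// ltW.
    lra.
  lra.
move: bn h; move: (a ^+ n) (V n) => x v.
nra.
Qed.

Let measurable_V (V : nat -> R) (n : nat) : measurable_fun setT (fun _ : R => (V n)%:E).
Proof. exact: measurable_cst. Qed.

Let Y0_law n : P (Y 0 @^-1` [set n]) = (pi0 n)%:E.
Proof.
have := @YS 0 (fun=> n) (fun=> setT) (fun=> measurableT).
rewrite big_geq// big_nat1 mule1.
have -> : exponential_prob (c + n%:R) setT = 1%E.
  exact: (probability_setT (exponential_law (rate_gt0 n))).
rewrite mule1 => <-; congr (P _); apply/seteqP; split=> w /=.
  by move=> h j /=; rewrite leqn0 => /eqP ->.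
by move=> /(_ 0%N isT)[].
Qed.

Lemma stopped_mean0 (f : nat -> R -> \bar R) :
  (forall n, measurable_fun setT (f n)) -> (forall n a, 0 <= f n a)%E ->
  stopped_mean 0 f = (\sum_(n <oo) (pi0 n)%:E * f n 0%R)%E.
Proof.
move=> mf f0; rewrite /stopped_mean.
have -> : alive 0 = \bigcup_n (Y 0 @^-1` [set n]).
  by apply/seteqP; split=> w // _; exists (Y 0 w).
rewrite ge0_integral_bigcup//; last 3 first.
- by move=> n; exact: measurable_funPTI.
- by apply: measurable_funTS; exact: measurable_fun_nat_comp.
- by apply/trivIsetP => i j _ _ /eqP ij; apply/seteqP; split=> // w /= [-> ].
apply: eq_eseriesr => n _.
rewrite (eq_integral (fun=> f n 0)); last first.
  by move=> w; rewrite inE/= => ->; rewrite /arrival big_geq.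
rewrite integral_cst; last exact: measurable_funPTI.
by rewrite muleC; congr (_ * _)%E; exact: Y0_law.
Qed.

Hypothesis pi0E : forall n, pi0 n = poisson_pmf c n.

Let poisson_pgf (x k : R) : 0 <= x -> 0 <= k ->
  (\sum_(n <oo) (pi0 n)%:E * (k * x ^+ n)%:E = (k * expR (c * (x - 1)))%:E)%E.
Proof.
move=> x0 k0.
transitivity (\sum_(n <oo) (k * expR (- c))%:E * (exp_coeff (c * x) n)%:E)%E.
  apply: eq_eseriesr => n _; rewrite pi0E /poisson_pmf c0 exp_coeffE/= -!EFinM; congr EFin.
  by rewrite exprMn; ring.
rewrite nneseriesZl; last by move=> n _; rewrite lee_fin exp_coeff_ge0// mulr_ge0// ltW.
have -> : (\sum_(n <oo) (exp_coeff (c * x) n)%:E = (expR (c * x))%:E)%E.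
  rewrite -EFin_lim; last exact: is_cvg_series_exp_coeff.
  by apply/congr_lim/funext => n /=; rewrite sumEFin.
by rewrite -EFinM mulrBr mulr1 expRD; congr EFin; ring.
Qed.

Let alive_Y_gt0 k w : alive k.+1 w -> {n | Y k w = n.+1}.
Proof. by move=> /(_ k (leqnn _)); case: (Y k w) => // n _; exists n. Qed.

Let alive_sub k : alive k.+1 `<=` alive k.
Proof. by rewrite aliveS => w []. Qed.

(** Each step taken off 0 lowers the mean of V by at least 1, so the probabilities of [alive] over
    positive indices sum to at most the initial mean of V. As they decrease, [P (alive k)] is
    O(1/k). *)
Lemma probability_alive_cvg0 : P (alive k) @[k --> \oo] --> 0%E.
Proof.
have [V [V0 [K K0 VK] hV]] := lyapunov.
have mV n := measurable_V V n.
pose I k := stopped_mean k (fun n _ => (V n)%:E).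
have mVY k (D : set T) : measurable_fun D (fun w => (V (Y k w))%:E).
  by apply: measurable_funTS; exact: (measurable_fun_nat_comp (Y k) (arrival k) mV).
have IS k : (I k.+1 + P (alive k.+1) <= I k)%E.
  rewrite /I stopped_meanS//; last by move=> n a; rewrite lee_fin.
  have -> : P (alive k.+1) = (\int[P]_(w in alive k.+1) 1)%E.
    by rewrite integral_cst// mul1e.
  rewrite -ge0_integralD//; last 2 first.
  - move=> w /alive_Y_gt0[n ->]; rewrite jump_op_const lee_fin addr_ge0// mulr_ge0//.
  - apply: measurable_funTS; under eq_fun do rewrite jump_op_const.
    exact: (measurable_fun_nat_comp (Y k) (arrival k) (measurable_V (fun n => jp n n.+1 * V n.+1 + jp n n.-1 * V n.-1))).
  apply: (@le_trans _ _ (\int[P]_(w in alive k.+1) (V (Y k w))%:E)%E).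
    apply: ge0_le_integral => //.
    - move=> w /alive_Y_gt0[n ->]; rewrite jump_op_const -EFinD lee_fin.
      by rewrite !addr_ge0// mulr_ge0.
    - apply: emeasurable_funD => //; apply: measurable_funTS; under eq_fun do rewrite jump_op_const.
      exact: (measurable_fun_nat_comp (Y k) (arrival k) (measurable_V (fun n => jp n n.+1 * V n.+1 + jp n n.-1 * V n.-1))).
    - move=> w /alive_Y_gt0[n ->]; rewrite jump_op_const -EFinD lee_fin; exact: hV.
  rewrite /stopped_mean; apply: ge0_subset_integral => //.
  by move=> w _; rewrite lee_fin.
(* The crude bound K 2^n on V suffices, since the Poisson generating function is finite at 2. *)
have I0 : (I 0%N <= (K * expR (c * (2 - 1)))%:E)%E.
  rewrite /I stopped_mean0//; last by move=> n a; rewrite lee_fin.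
  rewrite -poisson_pgf//; apply: lee_nneseries => n _.
    by rewrite mule_ge0// lee_fin.
  by rewrite lee_wpmul2l ?lee_fin.
have Pmono k l : (k <= l)%N -> (P (alive l) <= P (alive k))%E.
  move=> kl; apply: le_measure; rewrite ?inE// => w h j jk.
  exact: h (leq_trans jk kl).
have Ik k : (I k + k%:R%:E * P (alive k) <= I 0%N)%E.
  elim: k => [|k IH]; first by rewrite mul0e adde0.
  apply: le_trans IH; apply: (@le_trans _ _ (I k.+1 + P (alive k.+1) + k%:R%:E * P (alive k))%E); last first.
    by apply: leeD.
  have -> : (k.+1%:R%:E * P (alive k.+1) = P (alive k.+1) + k%:R%:E * P (alive k.+1))%E.
    by rewrite -nat1r EFinD ge0_muleDl ?lee_fin// mul1e.
  rewrite addeA; apply: leeD => //.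
  by apply: lee_wpmul2l; [rewrite lee_fin|exact: Pmono].
pose C := K * expR (c * (2 - 1)).
have bd k : (0 < k)%N -> (P (alive k) <= (C * k%:R^-1)%:E)%E.
  move=> k0; rewrite EFinM lee_pdivlMr ?ltr0n// muleC.
  apply: le_trans I0; apply: le_trans (Ik k).
  rewrite -[leLHS]add0e; apply: leeD => //.
  by apply: integral_ge0 => w _; rewrite lee_fin.
apply: (@squeeze_cvge _ _ _ _ (fun=> 0%E) (fun k => P (alive k)) (fun k => (C * k%:R^-1)%:E)).
- by apply: filterS (nbhs_infty_gt 0) => k k0; rewrite measure_ge0 bd.
- exact: cvg_cst.
- apply: cvg_EFin; first by apply: nearW.
  rewrite [X in _ --> X](_ : _ = C * 0); last by rewrite mulr0.
  by apply: cvgM; [exact: cvg_cst|exact: cvg_natV].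
Qed.

Definition hit (k : nat) : set T := alive k `&` Y k @^-1` [set 0%N].

Lemma measurable_hit k : measurable (hit k).
Proof. by apply: measurableI => //; exact: measurable_funPTI. Qed.

Lemma hit_uncovered : P (~` \bigcup_k hit k) = 0%E.
Proof.
have sub k : ~` (\bigcup_k hit k) `<=` alive k.
  move=> w hw; elim: k => [//|k IH]; rewrite aliveS; split=> //=.
  rewrite lt0n; apply/negP => /eqP Yk; apply: hw; exists k => //.
have mh : measurable (~` \bigcup_k hit k).
  by apply: measurableC; apply: bigcupT_measurable => k; exact: measurable_hit.
apply/eqP; rewrite eq_le measure_ge0 andbT.
rewrite -(cvg_lim _ probability_alive_cvg0)//; apply: lime_ge.
  by apply/cvg_ex; eexists; exact: probability_alive_cvg0.
by apply: nearW => k; apply: le_measure; rewrite ?inE.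
Qed.

(** Telescoping of the stopped martingale: step k releases the part that sits at 0, and the
    remainder is at most [P (alive k)]. The initial mean is e^-c for every t because the Poisson law
    is stationary. *)
Lemma sum_void_hit (t : R) : 0 <= t ->
  (\sum_(k <oo) \int[P]_(w in hit k) void_by t 0 (arrival k w) = (expR (- c))%:E)%E.
Proof.
move=> t0.
have mv n := measurable_void_by t n.
have v0 n a := void_by_ge0 t n a.
have mvY k (D : set T) : measurable_fun D (fun w => void_by t (Y k w) (arrival k w)).
  by apply: measurable_funTS; exact: measurable_fun_nat_comp.
have step k : (stopped_mean k (void_by t) =
    \int[P]_(w in hit k) void_by t 0 (arrival k w) + stopped_mean k.+1 (void_by t))%E.
  rewrite stopped_meanS// /stopped_mean.
  have -> : alive k = hit k `|` alive k.+1.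
    rewrite /hit aliveS; apply/seteqP; split=> w /=; last by case=> -[].
    by move=> h; case e : (Y k w) => [|n]; [left|right].
  rewrite ge0_integral_setU//; last 2 first.
  - exact: measurable_hit.
  - apply/disj_setPS => w [[_ /= e] /(_ k (leqnn _))]; by rewrite e.
  congr (_ + _)%E; apply: eq_integral => w; rewrite inE.
    by move=> [_ /= ->].
  by move=> /alive_Y_gt0[n ->]; rewrite jump_op_void_by.
have tot : stopped_mean 0 (void_by t) = (expR (- c))%:E.
  rewrite stopped_mean0//.
  transitivity (\sum_(n <oo) (pi0 n)%:E * (expR (- (c * (1 - expR (- t)))) * (1 - expR (- t)) ^+ n)%:E)%E.
    by apply: eq_eseriesr => n _; rewrite /void_by t0 subr0 mulrC.
  rewrite poisson_pgf ?expR_ge0//; last by rewrite subr_ge0 -expR0 ler_expR oppr_le0.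
  by rewrite -expRD; congr (expR _)%:E; ring.
have rem k : (0 <= stopped_mean k (void_by t) <= P (alive k))%E.
  rewrite integral_ge0//=.
  have -> : P (alive k) = (\int[P]_(w in alive k) 1)%E by rewrite integral_cst// mul1e.
  apply: ge0_le_integral => // w _.
  by rewrite lee_fin; case: ifP => // h; rewrite mminf_void_le1// subr_ge0.
have partial k : (\sum_(0 <= j < k) \int[P]_(w in hit j) void_by t 0 (arrival j w) + stopped_mean k (void_by t) = (expR (- c))%:E)%E.
  elim: k => [|k IH]; first by rewrite big_geq// add0e tot.
  by rewrite -IH (step k) big_nat_recr// -addeA.
have r0 : stopped_mean k (void_by t) @[k --> \oo] --> 0%E.
  apply: (@squeeze_cvge _ _ _ _ (fun=> 0%E) (fun k => stopped_mean k (void_by t)) (fun k => P (alive k))).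
  - exact: nearW.
  - exact: cvg_cst.
  - exact: probability_alive_cvg0.
apply/cvg_lim => //.
have : ((expR (- c))%:E - stopped_mean k (void_by t))%E @[k --> \oo] --> ((expR (- c))%:E - 0)%E.
  by apply: cvgeB => //; exact: cvg_cst.
rewrite sube0; apply: cvg_trans; apply: near_eq_cvg; apply: nearW => k /=.
rewrite -(partial k) addeK// ge0_fin_numE; last by have /andP[] := rem k.
have /andP[_ h] := rem k; apply: (le_lt_trans h).
by rewrite -ge0_fin_numE// fin_num_measure.
Qed.

End jump_chain.

(** * From the jump chain to the hitting time of 0 *)

Lemma exponential_prob_npos {R : realType} (rate : R) : 0 < rate ->
  exponential_prob rate `]-oo, 0] = 0%E.
Proof.
move=> r0; rewrite /exponential_prob.
have -> : `]-oo, 0]%classic = `]-oo, 0[ `|` [set 0 : R].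
  by apply/seteqP; split=> x /=; rewrite !in_itv/= le_eqVlt;
    [case/orP => [/eqP ->|->]; [right|left]|case=> [->|->]; rewrite ?eqxx ?orbT].
rewrite ge0_integral_setU//=.
- rewrite integral_set1 adde0; apply: integral0_eq => x /=; rewrite in_itv/= => x0.
  by rewrite lt0_exponential_pdf.
- apply/measurable_EFinP; apply: measurable_funTS; exact: measurable_exponential_pdf.
- by move=> x _; rewrite lee_fin exponential_pdf_ge0// ltW.
- by apply/disj_setPS => x /= [] /[swap] ->; rewrite in_itv/= ltxx.
Qed.

Section hitting_time.
Context {d : measure_display} {T : measurableType d} {R : realType}.
Variables (P : probability T R) (c : R) (Q : R -> {RV P >-> nat}).
Hypothesis c0 : 0 < c.
Hypothesis HQ : birth_death_process (fun=> c) (fun n : nat => n%:R) Q.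
Hypothesis Q0 : forall k : nat, P (Q 0 @^-1` [set k]) = (poisson_pmf c k)%:E.

(** Measurability of the hitting time: by right-continuity the infimum over all times equals the one
    over rational times, a countable infimum. Indices that code no rational stand for time 0, which
    does no harm. *)
Let rat_time (n : nat) : R := ratr (odflt 0 (unpickle n : option rat)).

Let rat_hit (n : nat) (w : T) : \bar R :=
  if (0 <= rat_time n) && (Q (rat_time n) w == 0%N) then (rat_time n)%:E else +oo%E.

Let hitting_time0E w : hitting_time0 Q w = einfs (rat_hit ^~ w) 0.
Proof.
have [rc _] := HQ.
apply/eqP; rewrite eq_le; apply/andP; split.
  apply/ereal_infP => _ [n _ <-] /=; rewrite /rat_hit.
  case: ifP => [/andP[n0 /eqP Qn]|_]; last exact: leey.
  by apply: ereal_inf_lbound; exists (rat_time n).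
apply/ereal_infP => _ [t [t0 Qt] <-]; apply/lee_addgt0Pr => e e0.
have [b /= b0 hb] := rc w t t0.
have tm : t < t + Order.min b e by rewrite ltrDl lt_min b0 e0.
have [q] := rat_in_itvoo tm; rewrite in_itv/= => /andP[tq qt].
apply: (@le_trans _ _ (ratr q)%:E).
  apply: ereal_inf_lbound; exists (pickle q) => //.
  rewrite /= /rat_hit /rat_time pickleK/= (le_trans t0 (ltW tq))/=.
  rewrite (hb (ratr q))//= ?Qt ?eqxx//.
  rewrite /ball_/= ltr0_norm ?subr_lt0// opprB ltrBlDl (lt_le_trans qt)//.
  by rewrite lerD2l ge_min lexx.
rewrite -EFinD lee_fin (le_trans (ltW qt))// lerD2l ge_min lexx orbT//.
Qed.

Lemma measurable_hitting_time0 : measurable_fun setT (hitting_time0 Q).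
Proof.
have -> : hitting_time0 Q = fun w => einfs (rat_hit ^~ w) 0.
  by apply/funext => w; exact: hitting_time0E.
apply: measurable_fun_einfs => n; rewrite /rat_hit.
case: (leP 0 (rat_time n)) => _ /=; last exact: measurable_cst.
apply: measurable_fun_if => //.
apply: (measurable_fun_bool true); rewrite setTI.
rewrite (_ : _ @^-1` _ = Q (rat_time n) @^-1` [set 0%N]); first exact: measurable_funPTI.
by apply/seteqP; split=> w /=; [move=> /eqP|move=> ->; rewrite eqxx].
Qed.

Lemma hitting_time0_ge0 w : (0 <= hitting_time0 Q w)%E.
Proof. by apply/ereal_infP => _ [t [t0 _] <-]; rewrite lee_fin. Qed.

Let tau (w : T) : R := fine (hitting_time0 Q w).

Let measurable_tau : measurable_fun setT tau.
Proof. by apply: measurableT_comp => //; exact: measurable_hitting_time0. Qed.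

Lemma hitting_time0_mean :
  {ae P, forall w, hitting_time0 Q w = (tau w)%:E} /\
  forall t : R, 0 <= t ->
    (\int[P]_w (if tau w <= t then mminf_return c (t - tau w) else 0)%:E =
     (expR (- c))%:E)%E.
Proof.
have [_ [Y [S [YS YQ]]]] := HQ.
have pi0 n : 0 <= poisson_pmf c n by exact: poisson_pmf_ge0.
have {}YS : forall (n : nat) (i : nat -> nat) (A : nat -> set R),
  (forall k, measurable (A k)) ->
  P (\bigcap_(k in [set k | (k <= n)%N]) (Y k @^-1` [set i k] `&` S k @^-1` A k)) =
  ((poisson_pmf c (i 0%N))%:E * (\prod_(0 <= k < n) jump_prob (fun=> c) (fun n => n%:R) (i k) (i k.+1))%:E
   * \prod_(0 <= k < n.+1) exponential_prob (c + (i k)%:R) (A k))%E.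
  by move=> n i A mA; rewrite YS// Q0.
(* A null holding time would leave the path no time in [Y k], and a visit to 0 could go unseen. The
   event is covered by countably many cylinders, one for each list of states. *)
have Spos : {ae P, forall w, forall k, 0 < S k w}.
  apply: ae_foralln => k.
  pose A (j : nat) : set R := if j == k then `]-oo, 0]%classic else setT.
  have mA j : measurable (A j) by rewrite /A; case: ifP.
  pose i (n : nat) : nat -> nat := nth 0%N (odflt [::] (unpickle n : option (seq nat))).
  pose F n := \bigcap_(j in [set j | (j <= k)%N])
    (Y j @^-1` [set i n j] `&` S j @^-1` A j).
  apply: (@negligibleS _ _ _ P (\bigcup_n F n)).
    move=> w /= /negP; rewrite -leNgt => Sk.
    exists (pickle (mkseq (fun j => Y j w) k.+1)) => //; rewrite /F /i pickleK => j /= jk.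
    split; first by rewrite /= nth_mkseq.
    by rewrite /A; case: eqP => [->|]//=; rewrite in_itv.
  apply: negligible_bigcup => n; apply/negligibleP.
    apply: bigcap_measurableType => j _.
    by apply: measurableI; exact: measurable_funPTI.
  apply: (etrans (YS k (i n) A mA)).
  rewrite [X in (_ * X)%E]big_nat_recr//= /A eqxx exponential_prob_npos ?mule0//.
  by rewrite ltr_wpDr.
pose hit := hit Y.
have mhit k : measurable (hit k) by exact: measurable_hit.
have hitT : {ae P, forall w, (\bigcup_k hit k) w}.
  apply/negligibleP; first by apply: measurableC; exact: bigcupT_measurable.
  exact: (hit_uncovered c0 pi0 YS).
(* Before [arrival k] the path runs through the positive states [Y j] with j < k; at [arrival k] it
   sits at 0. *)
have tauE : {ae P, forall w, forall k, hit k w -> hitting_time0 Q w = (arrival S k w)%:E}.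
  apply: filterS2 Spos YQ => w Sw Yw k [al Yk].
  have arr0 j : 0 <= arrival S j w by apply: sumr_ge0 => i _; exact: ltW.
  have arrS j : arrival S j.+1 w = arrival S j w + S j w by exact: arrivalS.
  apply/eqP; rewrite eq_le; apply/andP; split.
    apply: ereal_inf_lbound; exists (arrival S k w) => //; split => //.
    rewrite (Yw k)// -/(arrival S k w) -/(arrival S k.+1 w) lexx/=.
    by rewrite arrS ltrDl.
  apply/ereal_infP => _ [t [t0 Qt] <-]; rewrite lee_fin leNgt; apply/negP => tk.
  have [j jk /andP[jt tj]] : exists2 j, (j < k)%N & arrival S j w <= t < arrival S j.+1 w.
    elim: (k) tk => [|l IH] tl.
      by move: tl; rewrite /arrival big_geq// ltNge t0.
    have [lt|tl'] := leP (arrival S l w) t; first by exists l; rewrite ?lt.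
    by have [j jl h] := IH tl'; exists j => //; exact: leqW.
  have := al j jk; rewrite -(Yw j t) ?Qt//.
  by rewrite -/(arrival S j w) -/(arrival S j.+1 w) jt.
have tauE' : {ae P, forall w, hitting_time0 Q w = (tau w)%:E}.
  apply: filterS2 tauE hitT => w h [k _ hk].
  by rewrite /tau (h k hk).
split => // t t0.
pose g (x : R) : \bar R := (if x <= t then mminf_return c (t - x) else 0)%:E.
have gE x : g x = void_by c t 0 x by rewrite /g /void_by mminf_void0.
have mg : measurable_fun setT g.
  by rewrite (funext gE); exact: measurable_void_by.
have g0 x : (0 <= g x)%E by rewrite gE void_by_ge0.
have mgt : measurable_fun setT (fun w => g (tau w)) by exact: measurableT_comp.
rewrite -(sum_void_hit c0 pi0 YS (fun n => erefl) t0).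
rewrite (@ge0_negligible_integral _ _ _ _ _ (~` \bigcup_k hit k))//; last 3 first.
- by apply: measurableC; exact: bigcupT_measurable.
- by move=> w _; exact: g0.
- exact: (hit_uncovered c0 pi0 YS).
rewrite setTD setCK ge0_integral_bigcup//; last 3 first.
- exact: measurable_funTS.
- by move=> w _; exact: g0.
- apply/trivIsetP => i j _ _ ij; apply/seteqP; split=> // w /= [[ai Yi] [aj Yj]].
  move: ij; rewrite neq_ltn => /orP[ij|ji].
    by have := aj _ ij; rewrite Yi.
  by have := ai _ ji; rewrite Yj.
apply: eq_eseriesr => k _; apply: ge0_ae_eq_integral => //.
- exact: measurable_funTS.
- apply: measurable_funTS; apply: (@measurableT_comp _ _ _ _ _ _ (void_by c t 0)) => //.
  exact: measurable_void_by.
- by move=> w _; exact: g0.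
- by move=> w _; exact: void_by_ge0.
- apply: filterS tauE => w h hk; rewrite -gE; congr g.
  by rewrite /tau (h k hk).
Qed.

End hitting_time.

Section gumbel_plus_hitting_time.
Context {d : measure_display} {T : measurableType d} {R : realType}.
Variables (P : probability T R) (c : R) (Q : R -> {RV P >-> nat}) (G : {RV P >-> R}).
Hypothesis c0 : 0 < c.
Hypothesis HQ : birth_death_process (fun=> c) (fun n : nat => n%:R) Q.
Hypothesis Q0 : forall k : nat, P (Q 0 @^-1` [set k]) = (poisson_pmf c k)%:E.
Hypothesis HG : standard_gumbel G.
Hypothesis GQ : mutually_independent P
  (fun b : bool => if b then sigma_of G else sigma_of (hitting_time0 Q)).

Let tau (w : T) : R := fine (hitting_time0 Q w).

Let measurable_tau : measurable_fun setT tau.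
Proof. by apply: measurableT_comp => //; exact: measurable_hitting_time0 HQ. Qed.

#[local] HB.instance Definition _ := @isMeasurableFun.Build _ _ _ _ tau measurable_tau.

Let gumbel_tau_indep (A B : set R) : measurable A -> measurable B ->
  P (G @^-1` A `&` tau @^-1` B) = (P (G @^-1` A) * P (tau @^-1` B))%E.
Proof.
move=> mA mB.
have := GQ (s := [:: true; false])
  (A := fun b : bool => if b then G @^-1` A else tau @^-1` B) erefl.
rewrite big_cons big_seq1 => <-.
- congr (P _); apply/seteqP; split => [w [h1 h2] [] //|w h].
  by split; [exact: (h true)|exact: (h false)].
- move=> [] _; first by exists A => //; rewrite setTI.
  exists (fine @^-1` B); last by rewrite setTI.
  rewrite -[X in measurable X]setTI; exact: (@fine_measurable _ setT measurableT).
Qed.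

(** Given G, the mean over tau is e^-c when G <= t, by [hitting_time0_mean] at t - G, and 0
    otherwise since tau >= 0; what remains is the distribution function of G. *)
Lemma gumbel_hitting_time0_mean (t : R) :
  (\int[P]_w (if (G w + fine (hitting_time0 Q w) <= t)%R
              then mminf_return c (t - (G w + fine (hitting_time0 Q w))) else 0)%:E =
   (expR (- c) * expR (- expR (- t)))%:E)%E.
Proof.
have mG : measurable (G @^-1` `]-oo, t]) by exact: measurable_funPTI.
have [_ hm] := hitting_time0_mean c0 HQ Q0.
pose g (x : R) : \bar R := (if x <= t then mminf_return c (t - x) else 0)%:E.
have gE x : g x = void_by c t 0 x by rewrite /g /void_by mminf_void0.
have mg : measurable_fun setT g.
  by rewrite (funext gE); exact: measurable_void_by.
have g0 x : (0 <= g x)%E by rewrite gE void_by_ge0.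
rewrite -[LHS]/(\int[P]_w g (G w + tau w)%R)%E.
rewrite (@integral_add_indep _ _ _ P setT setT G tau (distribution P tau) 1%:nng g)//; last first.
  by move=> A B mA mB; rewrite !setTI mul1e; exact: gumbel_tau_indep.
rewrite mul1e (eq_integral (fun w => (expR (- c))%:E * (\1_(G @^-1` `]-oo, t]) w)%:E)%E).
  rewrite ge0_integralZl//; last first.
    by apply/measurable_EFinP; apply: measurable_indic; exact: measurable_funPTI.
  by rewrite integral_indic// setIT -[X in (_ * X)%E]/(cdf G t) HG -EFinM.
move=> w _; rewrite ge0_integral_distribution//; last first.
  by apply: measurableT_comp => //; exact: measurable_funD.
rewrite indicE; case: (leP (G w) t) => Gt.
  rewrite mem_set ?mule1; last by rewrite /= in_itv.
  have tG : 0 <= t - G w by rewrite subr_ge0.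
  have hG := hm _ tG.
  rewrite -hG; apply: eq_integral => w' _.
  by rewrite /= /g /tau lerBrDl opprD addrA.
rewrite memNset ?mule0; last by rewrite /= in_itv/= leNgt Gt.
apply: integral0_eq => w' _; rewrite /= /g ifF//.
apply/negbTE; rewrite -ltNge (lt_le_trans Gt)// lerDl.
by apply: fine_ge0; exact: hitting_time0_ge0.
Qed.

End gumbel_plus_hitting_time.

(** * Convergence of the distribution functions *)

Section quantile.
Context {R : realType}.
Variable c : R.
Hypothesis c0 : 0 < c.

(** The inverse function of [mminf_return c], meaningful for e^-c < q <= 1. *)
Definition mminf_quantile (q : R) : R := - ln (1 + ln q / c).

Variable q : R.
Hypothesis q_gt : expR (- c) < q.
Hypothesis q_le1 : q <= 1.

Let q0 : 0 < q. Proof. by rewrite (lt_trans _ q_gt)// expR_gt0. Qed.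

Let lnq : - c < ln q.
Proof. by rewrite -(expRK (- c)) ltr_ln// posrE ?expR_gt0. Qed.

Let arg_gt0 : 0 < 1 + ln q / c.
Proof. by rewrite -ltrBlDl sub0r ltr_pdivlMr// mulN1r. Qed.

Lemma mminf_quantile_ge0 : 0 <= mminf_quantile q.
Proof.
rewrite oppr_ge0 -ln1 ler_ln ?posrE// gerDl.
by rewrite pmulr_lle0 ?invr_gt0// -ln1 ler_ln ?posrE.
Qed.

Lemma mminf_quantileK : mminf_return c (mminf_quantile q) = q.
Proof.
rewrite /mminf_return /mminf_quantile opprK lnK ?posrE//.
rewrite opprD addrA subrr sub0r mulrN opprK mulrC divfK ?lnK ?posrE//.
by rewrite gt_eqF.
Qed.

Lemma mminf_quantile_le (y : R) : (mminf_quantile q <= y) = (mminf_return c y <= q).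
Proof.
rewrite -[in RHS]mminf_quantileK /mminf_return ler_expR lerN2 ler_pM2l//.
by rewrite lerD2l lerN2 ler_expR lerN2.
Qed.

End quantile.

Lemma mminf_return_noninc {R : realType} (c : R) (x y : R) : 0 <= c -> x <= y ->
  mminf_return c y <= mminf_return c x.
Proof.
by move=> c0 xy; rewrite ler_expR lerN2 ler_wpM2l// lerD2l lerN2 ler_expR lerN2.
Qed.

Lemma mminf_return_ge {R : realType} (c : R) (y : R) : 0 <= c ->
  expR (- c) <= mminf_return c y.
Proof.
move=> c0; rewrite ler_expR lerN2 -[leRHS]mulr1 ler_wpM2l//.
Qed.

Lemma mminf_return0 {R : realType} (c : R) : mminf_return c 0 = 1.
Proof. by rewrite /mminf_return oppr0 expR0 subrr mulr0 oppr0 expR0. Qed.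

Section step_approximation.
Context {R : realType}.
Variables (c : R) (J : nat).
Hypothesis c0 : 0 < c.
Hypothesis J0 : (0 < J)%N.

Definition mminf_mesh : R := (1 - expR (- c)) / J%:R.

(* The point where mminf_return crosses the level 1 - j rho / J, rho = 1 - e^-c;
   thus mminf_return is within rho / J of a step function with J - 1 jumps. *)
Definition mminf_grid (j : nat) : R := mminf_quantile c (1 - j%:R * mminf_mesh).

Let rho_gt0 : 0 < 1 - expR (- c).
Proof. by rewrite subr_gt0 -[ltRHS]expR0 ltr_expR oppr_lt0. Qed.

Let mesh_gt0 : 0 < mminf_mesh.
Proof. by rewrite divr_gt0// ltr0n. Qed.

Let meshJ : J%:R * mminf_mesh = 1 - expR (- c).
Proof. by rewrite mulrC divfK// pnatr_eq0 -lt0n. Qed.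

Let level_gt (j : nat) : (j < J)%N -> expR (- c) < 1 - j%:R * mminf_mesh.
Proof.
by move=> jJ; rewrite ltrBrDl addrC -ltrBrDl -meshJ ltr_pM2r// ltr_nat.
Qed.

Let level_le1 (j : nat) : 1 - j%:R * mminf_mesh <= 1.
Proof. by rewrite gerDl oppr_le0 mulr_ge0// ltW. Qed.

Lemma mminf_mesh_ge0 : 0 <= mminf_mesh. Proof. exact: ltW. Qed.

Lemma mminf_grid_ge0 (j : nat) : (j < J)%N -> 0 <= mminf_grid j.
Proof. by move=> jJ; rewrite mminf_quantile_ge0// level_gt. Qed.

Lemma mminf_return_grid (j : nat) : (j < J)%N ->
  mminf_return c (mminf_grid j) = 1 - j%:R * mminf_mesh.
Proof. by move=> jJ; rewrite mminf_quantileK// level_gt. Qed.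

(** A nonincreasing g that is e-close to [mminf_return] at the grid points is squeezed between
    consecutive levels, uniformly in y. It is used for [mminf_return] itself, with e = 0, and for
    the discrete return probabilities. *)
Lemma step_approx (g : R -> R) (e : R) :
  (forall x y, 0 <= x -> x <= y -> g y <= g x) ->
  (forall j, (j < J)%N -> `|g (mminf_grid j) - mminf_return c (mminf_grid j)| <= e) ->
  (forall y, 0 <= y -> expR (- c) - e <= g y) ->
  forall y, 0 <= y ->
  `|g y - (1 - mminf_mesh * \sum_(1 <= j < J) (mminf_grid j <= y)%R%:R)| <= mminf_mesh + e.
Proof.
move=> gmono gr glow y y0.
(* The drop of [mminf_return] up to y in units of the mesh: its integer part counts the grid points
   passed, the one at index 0 left out. *)
pose x := (1 - mminf_return c y) / mminf_mesh.
have x0 : 0 <= x.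
  rewrite divr_ge0 ?(ltW mesh_gt0)// subr_ge0 -(mminf_return0 c).
  by rewrite mminf_return_noninc// ltW.
have gridE j : (j < J)%N -> (mminf_grid j <= y) = (j <= Num.truncn x)%N.
  move=> jJ; rewrite mminf_quantile_le ?level_gt// truncn_ge_nat//.
  by rewrite ler_pdivlMr// lerBrDl addrC -lerBrDl.
have xJ : (Num.truncn x < J)%N.
  rewrite truncn_lt_nat// ltr_pdivrMr// meshJ ltrD2l ltrN2.
  rewrite ltr_expR ltrN2 -[ltRHS]mulr1 ltr_pM2l//.
  by rewrite gtrDl oppr_lt0 expR_gt0.
set k := Num.truncn x in gridE xJ.
have -> : \sum_(1 <= j < J) ((mminf_grid j <= y)%R%:R : R) = k%:R.
  rewrite (@big_cat_nat _ _ _ k.+1)//=.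
  rewrite (eq_big_nat _ _ (F2 := fun=> 1)); last first.
    move=> j /andP[j1 jk]; rewrite gridE ?(leq_trans _ xJ)//.
    by rewrite -ltnS jk.
  rewrite [X in _ + X](eq_big_nat _ _ (F2 := fun=> 0)); last first.
    by move=> j /andP[kj jJ]; rewrite gridE// leqNgt kj.
  by rewrite !sumr_const_nat subn1 mul0rn addr0.
have k_le : mminf_grid k <= y by rewrite gridE.
have up : g y <= 1 - k%:R * mminf_mesh + e.
  have := gr _ xJ; rewrite mminf_return_grid// ler_norml => /andP[_].
  rewrite lerBlDr addrC; apply: le_trans.
  by apply: gmono => //; exact: mminf_grid_ge0.
have lo : 1 - k.+1%:R * mminf_mesh - e <= g y.
  have [kJ|Jk] := ltnP k.+1 J.
    have := gr _ kJ; rewrite mminf_return_grid// ler_norml => /andP[+ _].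
    rewrite lerBrDl => h; apply: (le_trans h).
    by apply: gmono => //; rewrite ltW// ltNge gridE// -ltnNge.
  (* There is no grid point after y, and the next level is exactly e^-c; the floor on g takes
     over. *)
  have -> : k.+1 = J by apply/eqP; rewrite eqn_leq xJ Jk.
  by rewrite meshJ opprB addrCA subrr addr0 glow.
rewrite ler_norml; move: up lo; rewrite -natr1 mulrDl mul1r (mulrC k%:R).
move: (mminf_mesh * _) => z; have := mminf_mesh_ge0; lra.
Qed.

End step_approximation.

(* The total weight a * size s of the shifts is at most rho < 1, so a uniform
   bound b on the eventual differences improves to rho * b. *)
Lemma renewal_contraction {R : realType} (rho : R) (F : nat -> R -> R) (G : R -> R) :
  0 <= rho < 1 -> (forall t, \forall m \near \oo, `|F m t - G t| <= 1) ->
  (forall e, 0 < e -> exists a (s : seq R), [/\ 0 <= a, a * (size s)%:R <= rho &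
    forall t, \forall m \near \oo,
      `|(F m t - G t) - a * \sum_(r <- s) (F m (t - r) - G (t - r))| <= e]) ->
  forall t, F m t @[m --> \oo] --> G t.
Proof.
move=> /andP[rho0 rho1] FG1 hc.
pose H (b : R) := forall t, \forall m \near \oo, `|F m t - G t| <= b.
have Hstep b e : 0 < e -> 0 <= b -> H b -> H (rho * b + e).
  move=> e0 b0 Hb t; have [a [s [a0 as_ hs]]] := hc e e0.
  have : \forall m \near \oo, `|\sum_(r <- s) (F m (t - r) - G (t - r))| <= (size s)%:R * b.
    elim: s {as_ hs} => [|r s IH].
      by apply: nearW => m; rewrite big_nil normr0 mul0r.
    apply: filterS2 (Hb (t - r)) IH => m h1 h2.
    rewrite big_cons (le_trans (ler_normD _ _))//= -natr1 mulrDl mul1r addrC.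
    exact: lerD.
  apply: filterS2 (hs t) => m h1 h2.
  move: h1 h2; set D := F m t - G t; set S := \sum_(_ <- _) _ => h1 h2.
  rewrite -[D](subrK (a * S)) (le_trans (ler_normD _ _))// addrC lerD//.
  rewrite normrM (ger0_norm a0) (le_trans (ler_wpM2l a0 h2))// mulrA.
  exact: ler_wpM2r.
have rho1' : 0 < 1 - rho by rewrite subr_gt0.
(* The number e / (1 - rho) is the fixed point of b |-> rho b + e, so iterating from the bound 1
   only shrinks the excess, by a factor rho each time. *)
have Hn e : 0 < e -> forall n, H (rho ^+ n + e / (1 - rho)).
  move=> e0; elim=> [|n IH].
    move=> t; apply: filterS (FG1 t) => m /le_trans; rewrite expr0; apply; rewrite lerDl.
    by rewrite divr_ge0 ?ltW.
  have := Hstep _ _ e0 _ IH; rewrite addr_ge0 ?exprn_ge0 ?divr_ge0 ?(ltW e0) ?(ltW rho1')//.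
  move=> /(_ isT); congr H; rewrite exprS; field.
  by rewrite gt_eqF.
move=> t; apply/cvgrPdist_le => e e0.
have e2 : 0 < (1 - rho) * (e / 2) by rewrite mulr_gt0// divr_gt0.
have [n hn] : exists n, rho ^+ n <= e / 2.
  have /cvgr0Pnorm_le/(_ (e / 2)) : (rho ^+ n : R) @[n --> \oo] --> 0.
    by apply: cvg_expr; rewrite ger0_norm.
  rewrite divr_gt0// => /(_ isT)[N _ h]; exists N.
  by have := h N (leqnn _); rewrite /= ger0_norm// exprn_ge0.
apply: filterS (Hn _ e2 n t) => m; rewrite distrC => /le_trans; apply.
rewrite mulrAC divff ?gt_eqF// mul1r.
by rewrite [leRHS]splitr lerD2r.
Qed.

(* Replacing v by a step function turns the convolution of f and v into a
   combination of shifted distribution functions of f. *)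
Lemma step_mean_discrete {R : realType} (f v : nat -> R) (m : nat) (a e A : R) (s : seq R) :
  (0 < m)%N -> 0 <= A -> 0 <= e -> f 0%N = 0 -> (forall k, 0 <= f k) ->
  (forall n, \sum_(0 <= k < n.+1) f k <= 1) ->
  all (fun r => 0 <= r) s ->
  (forall y, 0 <= y -> `|v (Num.truncn (m%:R * y)) -
     (1 - a * \sum_(r <- s) (r <= y)%R%:R)| <= e) ->
  `|\sum_(0 <= k < (Num.truncn A).+1) f k * v (Num.truncn A - k)%N -
    (\sum_(0 <= k < (Num.truncn A).+1) f k -
     a * \sum_(r <- s) \sum_(0 <= k < (Num.truncn (A - m%:R * r)).+1) f k)| <= e.
Proof.
move=> m0 A0 e0 f0 f_ge0 f_le1 s0 hv.
have m0' : 0 < m%:R :> R by rewrite ltr0n.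
set N := Num.truncn A.
have NA : N%:R <= A by have /andP[] := truncn_itv A0.
(* Shortening the sum by m r amounts to an indicator inside it. When A - m r is negative the
   truncation is 0 and the sum still has its term k = 0, which is harmless because f vanishes
   there. *)
have fE r : 0 <= r -> \sum_(0 <= k < (Num.truncn (A - m%:R * r)).+1) f k =
    \sum_(0 <= k < N.+1) f k * (r <= (A - k%:R) / m%:R)%R%:R.
  move=> r0; set B := A - m%:R * r.
  have BN : (Num.truncn B <= N)%N by rewrite le_truncn// /B gerBl mulr_ge0// ltW.
  have kE k : (r <= (A - k%:R) / m%:R) = (k%:R <= B).
    by rewrite ler_pdivlMr// lerBrDl /B lerBrDl mulrC addrC.
  rewrite [RHS](@big_cat_nat _ _ _ (Num.truncn B).+1)//= [X in _ = _ + X]big1_seq ?addr0.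
    rewrite big_nat [RHS]big_nat; apply: eq_bigr => k /andP[_ kB]; rewrite kE.
    have [B0|B0] := leP 0 B; first by rewrite -truncn_ge_nat// -ltnS kB mulr1.
    have k0 : k = 0%N.
      have tB : Num.truncn B = 0%N.
        by apply/truncn0Pn; rewrite -ltNge (lt_trans B0).
      by move: kB; rewrite tB ltnS leqn0 => /eqP.
    by rewrite k0 f0 mul0r.
  move=> [|k]; rewrite mem_index_iota => /andP[_ /andP[Bk _]] //; rewrite kE.
  by rewrite leNgt -truncn_le_nat -ltnS Bk mulr0.
have -> : \sum_(r <- s) \sum_(0 <= k < (Num.truncn (A - m%:R * r)).+1) f k =
    \sum_(0 <= k < N.+1) f k * \sum_(r <- s) (r <= (A - k%:R) / m%:R)%R%:R.
  rewrite (eq_big_seq (fun r => \sum_(0 <= k < N.+1) f k * (r <= (A - k%:R) / m%:R)%R%:R)).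
    by rewrite exchange_big; apply: eq_bigr => k _; rewrite big_distrr.
  by move=> r rs; apply: fE; exact: (allP s0).
rewrite big_distrr -!sumrB/=.
rewrite big_nat (eq_bigr (fun k => f k * (v (N - k)%N -
    (1 - a * \sum_(r <- s) (r <= (A - k%:R) / m%:R)%R%:R)))); last first.
  by move=> k _; ring.
rewrite -big_nat (le_trans (ler_norm_sum _ _ _))//.
apply: (@le_trans _ _ (\sum_(0 <= k < N.+1) f k * e)); last first.
  by rewrite -big_distrl/= -[leRHS]mul1r ler_wpM2r.
rewrite big_nat [leRHS]big_nat; apply: ler_sum => k /andP[_ kN].
rewrite normrM ger0_norm// ler_wpM2l//.
have kA : k%:R <= A by rewrite (le_trans _ NA)// ler_nat.
have := hv ((A - k%:R) / m%:R); rewrite divr_ge0 ?subr_ge0// => /(_ isT).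
rewrite mulrC divfK ?gt_eqF// (_ : Num.truncn (A - k%:R) = (N - k)%N)//.
apply: truncn_def; have /andP[_ AN] := truncn_itv A0.
by rewrite natrB// lerB// -natr1 natrB//= addrAC ltrD2r natr1.
Qed.

Lemma step_mean_integral {d : measure_display} {T : measurableType d} {R : realType}
    (P : probability T R) (Z : {RV P >-> R}) (g : R -> R) (a e t I : R) (s : seq R) :
  measurable_fun setT g -> 0 <= a -> 0 <= e -> all (fun r => 0 <= r) s ->
  (forall y, 0 <= g y) ->
  (forall y, 0 <= y -> `|g y - (1 - a * \sum_(r <- s) (r <= y)%R%:R)| <= e) ->
  (\int[P]_w (if Z w <= t then g (t - Z w) else 0)%:E = I%:E)%E ->
  `|I - (fine (cdf Z t) - a * \sum_(r <- s) fine (cdf Z (t - r)))| <= e.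
Proof.
move=> mg a0 e0 s0 g0 hg hI.
pose h (w : T) : \bar R := (if Z w <= t then g (t - Z w) else 0)%:E.
pose one x (w : T) : \bar R := (\1_(Z @^-1` `]-oo, x]) w)%:E.
have mZ x : measurable (Z @^-1` `]-oo, x]) by exact: measurable_funPTI.
have {}hI : (\int[P]_w h w = I%:E)%E by exact: hI.
have mh : measurable_fun setT h.
  apply/measurable_EFinP; apply: measurable_fun_if => //.
  - apply: measurable_fun_ler => //.
  - by apply: measurable_funTS; apply: measurableT_comp => //; exact: measurable_funB.
have h0 w : (0 <= h w)%E by rewrite /h lee_fin; case: ifP.
have mone x : measurable_fun setT (one x).
  by apply/measurable_EFinP; exact: measurable_indic.
have one0 x w : (0 <= one x w)%E by rewrite lee_fin.
have Ione x : (\int[P]_w one x w = (fine (cdf Z x))%:E)%E.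
  by rewrite integral_indic// setIT fineK// fin_num_measure.
pose S (w : T) : \bar R := (a%:E * \sum_(r <- s) one (t - r)%R w)%E.
have mS : measurable_fun setT S.
  by apply: measurable_funeM; apply: emeasurable_sum => r.
have S0 w : (0 <= S w)%E.
  by rewrite mule_ge0// sume_ge0.
have IS : (\int[P]_w S w = (a * \sum_(r <- s) fine (cdf Z (t - r)))%:E)%E.
  rewrite ge0_integralZl//; last 2 first.
  - by apply: emeasurable_sum => r.
  - by move=> w _; exact: sume_ge0.
  rewrite ge0_integral_sum// EFinM -sumEFin; congr (_ * _)%E.
  by apply: eq_bigr => r _; exact: Ione.
have Ie : (\int[P]_w e%:E = e%:E)%E.
  rewrite integral_cst// -[RHS]mule1; congr (_ * _)%E; exact: probability_setT.
(* Both bounds are arranged without subtraction, so that they integrate as inequalities between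
   nonnegative functions. *)
have key w : (h w + S w <= one t w + e%:E)%E /\ (one t w <= h w + S w + e%:E)%E.
  rewrite /h /S /one sumEFin -!EFinM -!EFinD !lee_fin !indicE.
  have Zx x : (w \in Z @^-1` `]-oo, x]) = (Z w <= x).
    by apply/idP/idP; rewrite inE /= in_itv.
  rewrite Zx (eq_bigr (fun r => (r <= t - Z w)%R%:R)); last first.
    by move=> r _; rewrite indicE Zx lerBrDl lerBrDr.
  case: (leP (Z w) t) => Zt; last first.
    rewrite big1_seq ?mulr0 ?addr0 ?add0r ?e0//.
    move=> r /andP[_ rs]; rewrite leNgt (lt_le_trans _ (allP s0 _ rs))//.
    by rewrite subr_lt0.
  have := hg (t - Z w); rewrite subr_ge0 => /(_ Zt); rewrite ler_norml.
  move: (g _) (_ * _) => x y /=; lra.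
have [mo1 mo2] : measurable_fun setT (fun w => one t w + e%:E)%E /\
    measurable_fun setT (fun w => h w + S w)%E.
  by split; exact: emeasurable_funD.
have le1 : (I%:E + (a * \sum_(r <- s) fine (cdf Z (t - r)))%:E <=
    (fine (cdf Z t))%:E + e%:E)%E.
  rewrite -hI -IS -Ione -Ie -!ge0_integralD//.
  apply: ge0_le_integral => //; last by move=> w _; have [] := key w.
  by move=> w _; rewrite adde_ge0.
have le2 : ((fine (cdf Z t))%:E <= I%:E +
    (a * \sum_(r <- s) fine (cdf Z (t - r)))%:E + e%:E)%E.
  rewrite -hI -IS -Ione -Ie -!ge0_integralD//.
  - apply: ge0_le_integral => //; last by move=> w _; have [] := key w.
    exact: emeasurable_funD.
  - by move=> w _; rewrite adde_ge0.
move: le1 le2; rewrite -!EFinD !lee_fin ler_norml.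
move: (fine _) (_ * _) => x y; lra.
Qed.

Lemma near_coupon_time_ge0 {R : realType} (t : R) :
  \forall m \near \oo, 0 <= m%:R * ln m%:R + m%:R * t.
Proof.
apply: filterS2 (nbhs_infty_gt 0) (nbhs_infty_ger (expR (- t))) => m m0 me.
rewrite -mulrDr mulr_ge0// -lerBlDr sub0r -(expRK (- t)) ler_ln// posrE ?expR_gt0//.
by rewrite ltr0n.
Qed.

Lemma wsum_pred_le1 {R : realType} (m n : nat) (p : R) (phi : pred (seq (nat * bool))) :
  (0 < m)%N -> 0 <= p <= 1 -> wsum m p n (fun s => (phi s)%:R) <= 1.
Proof.
move=> m0 p01; rewrite -[leRHS](@wsum1 _ _ p m0 n).
rewrite [leRHS](@eq_wsum _ _ _ _ _
  (fun s => \sum_(b <- [:: true; false]) ((phi s == b)%:R : R))); last first.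
  by move=> s _ _; rewrite !big_cons big_nil; case: (phi s); rewrite /= !addr0 ?add0r.
rewrite wsum_sum !big_cons big_nil addr0.
rewrite (@eq_wsum _ _ _ _ (fun s => (phi s)%:R) (fun s => (phi s == true)%:R)); last first.
  by move=> s _ _; rewrite eqb_id.
by rewrite lerDl wsum_ge0.
Qed.

Section clumsy_contraction.
Context {R : realType}.
Variables (c : R) (p : nat -> R).
Hypothesis c0 : 0 < c.
Hypothesis p01 : forall m, (0 < m)%N -> 0 <= p m < 1.
Hypothesis pc : p ~_\oo (fun m : nat => c / m%:R).

(** Convergence is known for each fixed y; by monotonicity the finitely many grid points are enough
    to make the bound uniform in y. *)
Lemma clumsy_return_step_approx (J : nat) (e : R) : (0 < J)%N -> 0 < e ->
  \forall m \near \oo, forall y, 0 <= y ->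
  `|clumsy_return p m (Num.truncn (m%:R * y)) -
    (1 - mminf_mesh c J * \sum_(1 <= j < J) (mminf_grid c J j <= y)%R%:R)|
  <= mminf_mesh c J + e.
Proof.
move=> J0 e0.
have grid : \forall m \near \oo, forall j : 'I_J,
    `|mminf_return c (mminf_grid c J j) -
      clumsy_return p m (Num.truncn (m%:R * mminf_grid c J j))| <= e.
  apply: filter_forall => j; apply: cvg_near_dist => //.
  by apply: (cvg_clumsy_return p01 pc); exact: mminf_grid_ge0.
have low := cvg_near_dist (cvg_exprn_1B p01 pc) e0.
apply: filterS3 (nbhs_infty_gt 0) grid low => m m0 hgrid hlow y y0.
apply: (@step_approx _ c J c0 J0 (fun y => clumsy_return p m (Num.truncn (m%:R * y)))) => //.
- move=> x z x0 xz; apply: clumsy_return_noninc => //.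
  by rewrite le_truncn// ler_wpM2l.
- by move=> j jJ; rewrite distrC; exact: (hgrid (Ordinal jJ)).
- move=> z z0; apply: (@le_trans _ _ ((1 - p m) ^+ m)); last exact: clumsy_return_ge.
  by move: hlow; rewrite ler_norml => /andP[_]; rewrite lerBlDr addrC lerBlDr.
Qed.

(** The distribution function of the normalised collection time, written through the law of the
    first completion so that the renewal equation applies. *)
Definition clumsy_cdf (m : nat) (t : R) : R :=
  \sum_(0 <= k < (Num.truncn (m%:R * ln m%:R + m%:R * t)).+1)
    wsum m (p m) k (fun s => (first_complete m s)%:R).

Lemma first_complete_wsum_ge0 (m k : nat) : (0 < m)%N ->
  0 <= wsum m (p m) k (fun s => (first_complete m s)%:R).
Proof.
by move=> m0; have /andP[p0 p1] := p01 m0; rewrite wsum_ge0 ?p0 ?(ltW p1).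
Qed.

Lemma first_complete_wsum_le1 (m n : nat) : (0 < m)%N ->
  \sum_(0 <= k < n.+1) wsum m (p m) k (fun s => (first_complete m s)%:R) <= 1.
Proof.
move=> m0; have /andP[p0 p1] := p01 m0.
by rewrite -wsum_ever_complete// wsum_pred_le1// p0 ltW.
Qed.

Lemma clumsy_renewal (m n : nat) : (0 < m)%N ->
  clumsy_full p m n = \sum_(0 <= k < n.+1)
    wsum m (p m) k (fun s => (first_complete m s)%:R) * clumsy_return p m (n - k).
Proof.
move=> m0; have /andP[p0 p1] := p01 m0.
rewrite /clumsy_full -(@wsum_holds_all _ m (p m) m0 false n (-1)); last first.
  by rewrite subrr mulr0.
rewrite wsum_renewal//; apply: eq_bigr => k _; congr (_ * _).
rewrite /clumsy_return -(@wsum_holds_all _ m (p m) m0 true)//.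
rewrite mulrDr mulr1 mulrC divfK ?subrK// gt_eqF// subr_gt0//.
Qed.

Context {d : measure_display} {T : measurableType d}.
Variables (P : probability T R) (Z : {RV P >-> R}).
Hypothesis HZ : forall t, (\int[P]_w (if Z w <= t then mminf_return c (t - Z w) else 0)%:E =
   (expR (- c) * expR (- expR (- t)))%:E)%E.

Lemma clumsy_cdf_cvg (t : R) : clumsy_cdf m t @[m --> \oo] --> fine (cdf Z t).
Proof.
have ec1 : expR (- c) < 1 by rewrite -[ltRHS]expR0 ltr_expR oppr_lt0.
apply: (@renewal_contraction _ (1 - expR (- c)) clumsy_cdf (fun t => fine (cdf Z t))).
- by rewrite subr_ge0 (ltW ec1) gtrDl oppr_lt0 expR_gt0.
- move=> s; apply: filterS (nbhs_infty_gt 0) => m m0.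
  have f1 := first_complete_wsum_le1 (Num.truncn (m%:R * ln m%:R + m%:R * s)) m0.
  have f0 : 0 <= clumsy_cdf m s by apply: sumr_ge0 => k _; exact: first_complete_wsum_ge0.
  have g0 : 0 <= fine (cdf Z s) by rewrite fine_ge0// cdf_ge0.
  have g1 : fine (cdf Z s) <= 1.
    by rewrite -lee_fin fineK ?fin_num_measure ?cdf_le1.
  move: f1; rewrite -/(clumsy_cdf m s) ler_norml; move: f0 g0 g1; lra.
- move=> e e0; have e4 : 0 < e / 4 by rewrite divr_gt0.
  (* The mesh enters the total error twice, once for the discrete kernel and once for its limit, and
     e / 4 also enters twice, through [hu] and [hv]; a mesh of at most e / 4 keeps the sum below
     e. *)
  pose J := (Num.truncn (4 / e)).+1.
  have J0 : (0 < J)%N by [].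
  have mesh_le : mminf_mesh c J <= e / 4.
    rewrite /mminf_mesh ler_pdivrMr ?ltr0n//.
    have : 4 / e < J%:R by exact: truncnS_gt.
    rewrite ltr_pdivrMr// mulrC => h.
    apply: (@le_trans _ _ 1); first by rewrite gerDl oppr_le0 expR_ge0.
    by rewrite mulrAC ler_pdivlMr// mul1r ltW.
  have mesh0 : 0 <= mminf_mesh c J by exact: mminf_mesh_ge0.
  pose s := [seq mminf_grid c J j | j <- index_iota 1 J].
  have sE y : \sum_(r <- s) (r <= y)%R%:R = \sum_(1 <= j < J) (mminf_grid c J j <= y)%R%:R :> R.
    by rewrite big_map.
  have s0 : all (fun r => 0 <= r) s.
    apply/allP => _ /mapP[j + ->]; rewrite mem_index_iota => /andP[_ jJ].
    exact: mminf_grid_ge0.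
  exists (mminf_mesh c J), s; split => //.
    rewrite /mminf_mesh size_map size_iota mulrAC ler_pdivrMr ?ltr0n//.
    by rewrite ler_wpM2l ?subr_ge0 ?(ltW ec1)// ler_nat leq_subr.
  move=> x.
  have hZ : `|expR (- c) * expR (- expR (- x)) -
      (fine (cdf Z x) - mminf_mesh c J * \sum_(r <- s) fine (cdf Z (x - r)))| <= mminf_mesh c J.
    apply: (step_mean_integral _ mesh0 mesh0 s0 _ _ (HZ x)).
    - rewrite (_ : mminf_return c = mminf_void c 0); last first.
        by apply/funext => y; rewrite mminf_void0.
      by apply: continuous_measurable_fun => y; exact: continuous_mminf_void.
    - by move=> y; exact: expR_ge0.
    - move=> y y0; rewrite sE -[leRHS]addr0; apply: (@step_approx _ c J c0 J0) => //.
      + by move=> u v _ uv; exact: (mminf_return_noninc (ltW c0)).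
      + by move=> j _; rewrite subrr normr0.
      + by move=> u _; rewrite subr0 mminf_return_ge// ltW.
  have hu := cvg_near_dist (cvg_clumsy_full p01 pc (t := x)) e4.
  have hv := clumsy_return_step_approx J0 e4.
  apply: filterS2 (nbhs_infty_gt 0) (filterI (near_coupon_time_ge0 x) (filterI hu hv)) => m m0 [A0 [hum hvm]].
  have := @step_mean_discrete _ (fun k => wsum m (p m) k (fun s => (first_complete m s)%:R))
     (clumsy_return p m) m (mminf_mesh c J) (mminf_mesh c J + e / 4) _ s m0 A0.
  rewrite addr_ge0 ?(ltW e4)//= first_complete_nil// => /(_ isT erefl).
  move=> /(_ (fun k => first_complete_wsum_ge0 k m0) (fun n => first_complete_wsum_le1 n m0) s0).
  have hv' : forall y, 0 <= y -> `|clumsy_return p m (Num.truncn (m%:R * y)) -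
     (1 - mminf_mesh c J * \sum_(r <- s) (r <= y)%R%:R)| <= mminf_mesh c J + e / 4.
    by move=> y y0; rewrite sE; exact: hvm.
  move=> /(_ hv'); rewrite -clumsy_renewal// -/(clumsy_cdf m x).
  rewrite (eq_bigr (fun r => clumsy_cdf m (x - r))); last first.
    by move=> r _; rewrite /clumsy_cdf mulrBr addrA.
  rewrite sumrB mulrBr; move: hum hZ.
  rewrite !ler_norml; move: (mminf_mesh c J * _) (mminf_mesh c J * _) => S1 S2.
  move: mesh_le; move: (_ * expR _) (clumsy_full _ _ _) (mminf_mesh c J) (fine _) (clumsy_cdf _ _) => u1 u2 u3 u4 u5; lra.
Qed.

End clumsy_contraction.

Theorem theorem4p10 (R : realType) (c : R) (p : nat -> R)
    (d : nat -> measure_display) (T : forall m : nat, measurableType (d m))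
    (P : forall m : nat, probability (T m) R)
    (C : forall m : nat, nat -> {RV (P m) >-> nat})
    (U : forall m : nat, nat -> {RV (P m) >-> R})
    (d' : measure_display) (T' : measurableType d') (P' : probability T' R)
    (Q : R -> {RV P' >-> nat}) (G : {RV P' >-> R}) :
  0 < c ->
  (forall m : nat, (0 < m)%N -> 0 <= p m < 1) ->
  p ~_\oo (fun m : nat => c / m%:R) ->
  (forall m : nat, (0 < m)%N -> coupon_draws m (C m) (U m)) ->
  birth_death_process (fun=> c) (fun n : nat => n%:R) Q ->
  (forall k : nat, P' (Q 0 @^-1` [set k]) = (poisson_pmf c k)%:E) ->
  standard_gumbel G ->
  mutually_independent P' (fun b : bool =>
    if b then sigma_of G else sigma_of (hitting_time0 Q)) ->
  cvg_in_law P
    (fun m w => ((clumsy_time m (p m) (C m) (U m) w - (m%:R * ln m%:R)%:E)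
                 * (m%:R^-1)%:E)%E)
    P'
    (fun w => ((G w)%:E + hitting_time0 Q w)%E).
Proof.
move=> c0 p01 pc CU HQ Q0 HG GQ.
have [tauE _] := hitting_time0_mean c0 HQ Q0.
pose Z (w : T') : R := G w + fine (hitting_time0 Q w).
have mZ : measurable_fun setT Z.
  apply: measurable_funD => //; apply: measurableT_comp => //.
  exact: measurable_hitting_time0 HQ.
pose mfunZ := isMeasurableFun.Build _ _ _ _ Z mZ.
pose ZRV : {RV P' >-> R} := HB.pack Z mfunZ.
have ZE : {ae P', forall w, ((G w)%:E + hitting_time0 Q w = (Z w)%:E)%E}.
  by apply: filterS tauE => w ->; rewrite -EFinD.
split; first by apply: filterS ZE => w ->.
move=> x _.
have -> : P' [set w | ((G w)%:E + hitting_time0 Q w <= x%:E)%E] = (fine (cdf ZRV x))%:E.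
  rewrite fineK ?fin_num_measure//.
  (* The extended sum and Z agree off the null set N, so each of the two measurable events contains
     the other up to N. *)
  have [N [mN N0 hN]] := ZE.
  have hE w : ~ N w -> ((G w)%:E + hitting_time0 Q w = (Z w)%:E)%E.
    by move=> Nw; apply: contrapT => h; apply: Nw; exact: hN.
  have mA : measurable [set w | ((G w)%:E + hitting_time0 Q w <= x%:E)%E].
    rewrite -[X in measurable X]setTI; apply: emeasurable_fun_infty_c => //.
    apply: emeasurable_funD; first exact/measurable_EFinP.
    exact: measurable_hitting_time0 HQ.
  have mB : measurable (ZRV @^-1` `]-oo, x]) by exact: measurable_funPTI.
  have le_null (A B : set T') : measurable A -> measurable B -> A `<=` B `|` N ->
      (P' A <= P' B)%E.
    move=> mA' mB' AB; rewrite -(measureU0 mB' mN N0) le_measure// inE//.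
    exact: measurableU.
  apply/eqP; rewrite eq_le; apply/andP; split; apply: le_null => // w /=;
    have [Nw|/hE wE] := pselect (N w); try by right.
    by rewrite wE lee_fin => h; left; rewrite /= in_itv.
  by rewrite in_itv/= => h; left; rewrite wE lee_fin.
have hcvg : (clumsy_cdf p m x)%:E @[m --> \oo] --> (fine (cdf ZRV x))%:E.
  apply: cvg_EFin; first exact: nearW.
  exact: (@clumsy_cdf_cvg _ c p c0 p01 pc _ _ P' ZRV
    (gumbel_hitting_time0_mean c0 HQ Q0 HG GQ) x).
apply: cvg_trans hcvg; apply: near_eq_cvg.
(* For m large the threshold m log m + m x is nonnegative, as [clumsy_time_le] requires. *)
apply: filterS2 (nbhs_infty_gt 0) (near_coupon_time_ge0 x) => m m0 A0.
have m0' : 0 < m%:R :> R by rewrite ltr0n.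
rewrite /clumsy_cdf -wsum_ever_complete// -(P_draws m0 (p01 m m0) (CU m m0)).
congr (P m _); apply: eq_set => w.
by rewrite lee_pdivrMr// leeBlDr// -EFinM -EFinD (mulrC x) (addrC (_ * x)) clumsy_time_le.
Qed.
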